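(* Let $G$ be a connected ($P_5$, $4$-wheel)-free atom. Then the following hold: (1) If $G$ has an induced $5$-wheel, then $G$ is a nice graph. (2) If $G$ has an induced $C_5$ and has no induced $5$-wheel, then $G$ is either a nice graph or a quasi-line graph. (3) If $G$ has an induced $C_7^c$ and has no induced $C_5$, then $G$ is a nice graph.
   Context: All graphs are finite and simple. $P_k$ and $C_k$ are the chordless path and chordless cycle on $k$ vertices; $H^c$ is the complement of $H$. For $k\ge 4$, a $k$-wheel is the graph consisting of a $C_k$ plus one additional vertex adjacent to all vertices of the $C_k$. A graph is $\mathcal F$-free if no induced subgraph of it is isomorphic to a member of $\mathcal F$. A clique (stable set) is a set of pairwise adjacent (nonadjacent) vertices; $\omega(G)$ is the maximum size of a clique of $G$. A clique cutset of $G$ is a clique $Q$ such that $G-Q$ has more connected components than $G$; a graph is an atom if it has no clique cutset. A graph $G$ is a quasi-line graph if for each vertex $v$ the set of neighbors of $v$ can be expressed as the union of two cliques. A graph $G$ is nice if there are three pairwise disjoint stable sets $S_1,S_2,S_3$ in $G$ such that $\omega(G-(S_1\cup S_2\cup S_3))\le \omega(G)-2$. *)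

(* Defs.v *)
From Stdlib Require List.
From mathcomp Require Import all_boot.

Set Implicit Arguments.
Unset Strict Implicit.
Unset Printing Implicit Defensive.

Record sgraph := SGraph {
  vertex :> finType;
  adj : rel vertex;
  adj_sym : symmetric adj;
  adj_irr : irreflexive adj }.

Definition isomorphic (G H : sgraph) : Prop :=
  exists2 f : G -> H, bijective f & forall x y, adj (f x) (f y) = adj x y.

Section Induced.
Variables (G : sgraph) (S : {set G}).

Definition induced_adj : rel {x : G | x \in S} :=
  fun x y => adj (val x) (val y).

Lemma induced_adj_sym : symmetric induced_adj.
Proof. by move=> x y; exact: adj_sym. Qed.

Lemma induced_adj_irr : irreflexive induced_adj.
Proof. by move=> x; exact: adj_irr. Qed.

Definition induced : sgraph := SGraph induced_adj_sym induced_adj_irr.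
End Induced.

(* G - S *)
Definition del (G : sgraph) (S : {set G}) : sgraph := induced (~: S).

Definition has_induced (G H : sgraph) : Prop :=
  exists S : {set G}, isomorphic (induced S) H.

Definition free_of (F : seq sgraph) (G : sgraph) : Prop :=
  forall H, List.In H F -> ~ has_induced G H.

Section Compl.
Variable G : sgraph.

Definition compl_adj : rel G := fun x y => (x != y) && ~~ adj x y.

Lemma compl_adj_sym : symmetric compl_adj.
Proof. by move=> x y; rewrite /compl_adj eq_sym adj_sym. Qed.

Lemma compl_adj_irr : irreflexive compl_adj.
Proof. by move=> x; rewrite /compl_adj eqxx. Qed.

Definition compl : sgraph := SGraph compl_adj_sym compl_adj_irr.
End Compl.

Section PathGraph.
Variable k : nat.

Definition path_adj : rel 'I_k := fun i j => (i.+1 == j) || (j.+1 == i).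

Lemma path_adj_sym : symmetric path_adj.
Proof. by move=> i j; rewrite /path_adj orbC. Qed.

Lemma path_adj_irr : irreflexive path_adj.
Proof. by move=> i; rewrite /path_adj orbb gtn_eqF. Qed.

Definition path_graph : sgraph := SGraph path_adj_sym path_adj_irr.
End PathGraph.

Section CycleGraph.
Variable k : nat.

(* A cycle only for k >= 3; the conjunct i != j excludes the loop at k = 1. *)
Definition cycle_adj : rel 'I_k :=
  fun i j => (i != j) && ((i.+1 %% k == j) || (j.+1 %% k == i)).

Lemma cycle_adj_sym : symmetric cycle_adj.
Proof. by move=> i j; rewrite /cycle_adj eq_sym orbC. Qed.

Lemma cycle_adj_irr : irreflexive cycle_adj.
Proof. by move=> i; rewrite /cycle_adj eqxx. Qed.

Definition cycle_graph : sgraph := SGraph cycle_adj_sym cycle_adj_irr.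
End CycleGraph.

Section Wheel.
Variable k : nat.

(* None is the hub, Some i the i-th vertex of the rim. *)
Definition wheel_adj : rel (option 'I_k) := fun x y =>
  match x, y with
  | Some i, Some j => cycle_adj i j
  | None, None => false
  | _, _ => true
  end.

Lemma wheel_adj_sym : symmetric wheel_adj.
Proof. by case=> [i|] [j|] //=; exact: cycle_adj_sym. Qed.

Lemma wheel_adj_irr : irreflexive wheel_adj.
Proof. by case=> [i|] //=; exact: cycle_adj_irr. Qed.

Definition wheel : sgraph := SGraph wheel_adj_sym wheel_adj_irr.
End Wheel.

Definition clique (G : sgraph) (Q : {set G}) : Prop :=
  {in Q &, forall x y, x != y -> adj x y}.

Definition cliqueb (G : sgraph) (Q : {set G}) : bool :=
  [forall x in Q, forall y in Q, (x != y) ==> adj x y].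

Lemma cliqueP (G : sgraph) (Q : {set G}) : reflect (clique Q) (cliqueb Q).
Proof.
apply: (iffP forall_inP) => [h x y xQ yQ xy|h x xQ].
  by have /forall_inP/(_ y yQ)/implyP := h x xQ; apply.
by apply/forall_inP => y yQ; apply/implyP; exact: h.
Qed.

Definition stable (G : sgraph) (S : {set G}) : Prop :=
  {in S &, forall x y, ~~ adj x y}.

Definition omega (G : sgraph) : nat := \max_(Q : {set G} | cliqueb Q) #|Q|.

Definition connected (G : sgraph) : Prop :=
  forall x y : G, connect (@adj G) x y.

Definition components (G : sgraph) : nat := n_comp (@adj G) [set: G].

Definition clique_cutset (G : sgraph) (Q : {set G}) : Prop :=
  clique Q /\ components G < components (del Q).

Definition atom (G : sgraph) : Prop := forall Q : {set G}, ~ clique_cutset Q.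

Definition neighbors (G : sgraph) (v : G) : {set G} := [set x | adj v x].

Definition quasi_line (G : sgraph) : Prop :=
  forall v : G, exists A B : {set G},
    [/\ clique A, clique B & neighbors v = A :|: B].

(* The bound is omega (G - S) <= omega G - 2 over the integers: the 2 is moved
   to the left because subtraction on nat truncates at 0. *)
Definition nice (G : sgraph) : Prop :=
  exists S1 S2 S3 : {set G},
    [/\ [/\ stable S1, stable S2 & stable S3],
        [/\ [disjoint S1 & S2], [disjoint S1 & S3] & [disjoint S2 & S3]]
      & omega (del (S1 :|: S2 :|: S3)) + 2 <= omega G].

(* Main.v *)
Require Import Defs.
From mathcomp Require Import all_boot.

Set Implicit Arguments.
Unset Strict Implicit.
Unset Printing Implicit Defensive.

(* Fix an induced copy b of a small graph P in G and sort the vertices of G into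
   classes by their closed neighbourhood on b.  If G also avoids some other small
   graphs, then, by searching for these in b plus a few vertices, most
   adjacencies between classes are forced.  In this situation three stable sets can
   be prescribed classwise: every coloured class is P3-free, and each of its
   components contributes one representative.  A clique X of G that misses the
   three stable sets meets some set tau of classes, and for each tau that can
   occur one finds two vertices, outside X and adjacent to each other and to all
   of X, so that omega drops by 2.  In the symmetric cases one uses instead an
   exchange with a class of extremal size.  The vertices without neighbours on b
   are handled with the absence of clique cutsets: they form homogeneous cliques,
   which are coloured greedily.

   The theorem follows by running through a list of graphs P, each time avoiding
   graphs already treated, from the complement of the icosahedron down to the 5-wheel, to a C5 with a vertex v adjacent to exactly v_i, v_(i+2),
   v_(i-2), to a C5 with a vertex adjacent to exactly v_(i-1), v_(i+1), and to the
   complement of C7.  If G has a C5 but no other graph of the list, then G is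
   claw-free, and a claw-free graph without 4- and 5-wheels is quasi-line. *)

(** * Induced patterns *)

(** The problem becomes finite because a sufficient condition for enlarging a clique X by two
    vertices depends only on the set of classes that X meets. The obstacle that shapes the
    certificates is that a representative missed by X must be complete to X, and not only to its own
    component. Three reasons are used: the components of its class are homogeneous towards another
    class, or the representative is a base vertex whose neighbours are read off the traces, or the
    neighbourhoods of adjacent vertices of its class are nested and it has the largest one. A
    certificate needs no trust. Each nonzero entry asserts that some small configuration contains an
    avoided pattern, and this is verified by a search in its matrix; an entry that claims nothing
    only leaves more cases to the colouring. The comparison of class sizes in the symmetric cases
    comes from a choice of the embedding: the base is relabelled by an automorphism that moves a
    class of extremal size to a fixed place. *)

Definition bmatrix := seq (seq bool).

Section Patterns.
Variable G : sgraph.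
Implicit Types (x y z : G) (s t : seq G).

(* None of the patterns below has true twins, so in terms of closed adjacency a
   sequence that realizes one of them has no repetition, and configurations of
   vertices may be refuted without assuming the vertices distinct. *)
Definition radj x y := (x == y) || adj x y.

Lemma radj_refl : reflexive radj.
Proof. by move=> x; rewrite /radj eqxx. Qed.

Lemma radj_sym : symmetric radj.
Proof. by move=> x y; rewrite /radj eq_sym adj_sym. Qed.

Definition trace s x := [seq radj x y | y <- s].

Fixpoint tri s : bmatrix := if s is x :: s' then trace s' x :: tri s' else [::].

Definition contains (p : bmatrix) := exists s, tri s = p.

Definition rows s : bmatrix := [seq trace s x | x <- s].
End Patterns.

Fixpoint wf (p : bmatrix) : bool :=
  if p is r :: p' then (size r == size p') && wf p' else true.

(* In a search each vertex of the pattern carries a mask [c] of candidate rows of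
   the host [H]. *)
Fixpoint meet (b : bool) (c r : seq bool) : seq bool :=
  match c, r with
  | x :: c', y :: r' =>
    (if x then if b then y else ~~ y else false) :: meet b c' r'
  | _, _ => [::]
  end.

Fixpoint update (p : seq bool) (cs : bmatrix) (r : seq bool) : bmatrix :=
  match p, cs with
  | b :: p', c :: cs' => meet b c r :: update p' cs' r
  | _, _ => [::]
  end.

(** Conditionals replace the boolean connectives because [vm_compute] is call by value: a
    disjunction would evaluate both of its arguments and so explore every branch. *)
Fixpoint search (H p cs : bmatrix) {struct p} : bool :=
  match p, cs with
  | r :: p', c :: cs' =>
    (fix scan (c : seq bool) (h : bmatrix) {struct h} : bool :=
      match c, h with
      | x :: c', y :: h' =>
        if x then if search H p' (update r cs' y) then true else scan c' h'
        else scan c' h'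
      | _, _ => false
      end) c H
  | [::], [::] => true
  | _, _ => false
  end.

Definition extend (m : seq bool) (H : bmatrix) : bmatrix :=
  (true :: m) :: [seq br.1 :: br.2 | br <- zip m H].

Fixpoint full (p : bmatrix) : bmatrix :=
  if p is r :: p' then extend r (full p') else [::].

Fixpoint only (k : nat) (c : seq bool) : seq bool :=
  match c, k with
  | x :: c', 0 => x :: nseq (size c') false
  | _ :: c', k'.+1 => false :: only k' c'
  | [::], _ => [::]
  end.

(* Looks for the pattern among embeddings that use all of the rows [hs]; the [k]th
   row of the host is the next one to be used. *)
Fixpoint place (H p M : bmatrix) (hs : bmatrix) (k : nat) (cs : bmatrix) : bool :=
  if hs is h :: hs' then
    (fix scan (rs pre post : bmatrix) {struct rs} : bool :=
      match rs, post with
      | r :: rs', c :: post' =>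
        if nth false c k then
          if place H p M hs' k.+1 (update r (catrev pre (only k c :: post')) h)
          then true else scan rs' (c :: pre) post'
        else scan rs' (c :: pre) post'
      | _, _ => false
      end) M [::] cs
  else search H p cs.

(** The newest vertices come first in a host, and the search is pruned to the embeddings that use
    all of them. Soundness does not depend on this pruning. *)
Definition found (k : nat) (p H : bmatrix) : bool :=
  place H p (full p) (take k H) 0 (nseq (size p) (nseq (size H) true)).

(** * Soundness of the pattern search *)

Section Sound.
Variable G : sgraph.
Implicit Types (x y z : G) (s t : seq G).

Lemma rows_cons x s : rows (x :: s) = extend (trace s x) (rows s).
Proof.
rewrite /rows /extend /= radj_refl; congr (_ :: _).
have aux t : [seq trace (x :: s) y | y <- t] =
    [seq br.1 :: br.2 | br <- zip (trace t x) [seq trace s y | y <- t]].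
  by elim: t => //= y t ->; rewrite radj_sym.
exact: aux.
Qed.

Lemma full_tri s : full (tri s) = rows s.
Proof. by elim: s => //= x s ->; rewrite rows_cons. Qed.

Lemma mem_meet b c s x y :
  y \in mask (meet b c (trace s x)) s -> y \in mask c s /\ radj x y = b.
Proof.
elim: s c => [|z s IH] [|d c] //=.
case: d => /=; last exact: IH.
case: b IH => IH /=; case E: (radj x z) => /=.
- rewrite !inE => /orP[/eqP ->|/IH[-> ->]]; first by rewrite eqxx.
  by rewrite orbT.
- by move=> /IH[h ->]; rewrite inE h orbT.
- by move=> /IH[h ->]; rewrite inE h orbT.
- rewrite !inE => /orP[/eqP ->|/IH[-> ->]]; first by rewrite eqxx.
  by rewrite orbT.
Qed.

(** A nonempty mask at [i] witnesses that [i] is within the range of [update], which truncates to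
    the shorter of its lists; only there is the new mask the [meet] of the old one with the chosen
    row. *)
Lemma searchP s p cs : wf p -> search (rows s) p cs ->
  exists2 t, tri t = p &
    forall i, i < size t -> nth [::] cs i != [::] /\
      forall d, nth d t i \in mask (nth [::] cs i) s.
Proof.
elim: p cs => [|r p IH] [|c cs] //=; first by exists [::].
move=> /andP[/eqP szr wfp].
have H (h : seq G) : (fix scan (c : seq bool) (h : bmatrix) {struct h} : bool :=
    match c, h with
      | x :: c', y :: h' =>
        if x then if search (rows s) p (update r cs y) then true else scan c' h'
        else scan c' h'
      | _, _ => false
      end) c [seq trace s x | x <- h] ->
    exists2 x, x \in mask c h & search (rows s) p (update r cs (trace s x)).
  elim: h c => [|y h IHh] [|d c] //=.
  case: d => [|/IHh //]; case E: (search _ _ _).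
    by exists y => //; rewrite inE eqxx.
  by case/IHh=> x xc hx; exists x => //; rewrite inE xc orbT.
move/H => {H} [x xc /(IH _ wfp) [t tE ht]].
have szt : size t = size p by rewrite -tE; elim: (t) => //= a b ->.
have updE i : i < size t -> nth [::] (update r cs (trace s x)) i != [::] ->
    i < size r /\ nth [::] (update r cs (trace s x)) i =
    meet (nth false r i) (nth [::] cs i) (trace s x).
  move=> _; elim: (r) (cs) i => [|b r' IHr] [|c' cs'] [|i] //=.
  by move=> /IHr.
exists (x :: t) => [|[|i] /=].
- rewrite /= tE; congr (_ :: _).
  apply: (@eq_from_nth _ false); first by rewrite size_map szt szr.
  move=> i; rewrite size_map => it; rewrite (nth_map x) //.
  have [nn mm] := ht i it; have [ir E] := updE i it nn.
  by have := mm x; rewrite E => /mem_meet[].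
- move=> _; split=> //.
  by case: (c) xc.
rewrite ltnS => it; have [nn mm] := ht i it; have [ir E] := updE i it nn.
split=> [|d]; last by have := mm d; rewrite E => /mem_meet[].
by have := mm x; rewrite E => /mem_meet[]; case: (nth [::] cs i).
Qed.

(** Placing rows only changes the candidate masks, and [searchP] holds for all masks. *)
Lemma place_search H p M hs k cs :
  place H p M hs k cs -> exists cs', search H p cs'.
Proof.
elim: hs k cs => [|h hs IH] k cs /=; first by exists cs.
move: (place H p M hs) IH => P IH.
elim: M [::] cs => [|r M' IHM] pre [|c post] //=.
case: ifP => [_|_ /IHM //].
case E: (P _ _); last exact: IHM.
by move=> _; apply: IH E.
Qed.

Lemma found_contains k p s : wf p -> found k p (rows s) -> contains G p.
Proof.
by move=> wfp /place_search[cs /(searchP wfp)[t <- _]]; exists t.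
Qed.
End Sound.

(** * Colouring by classes *)

Section Cliques.
Variable G : sgraph.
Implicit Types (x y z : G) (X Y S : {set G}).

Definition complete x X := {in X, forall y, radj x y}.

Lemma cliqueE X : clique X <-> {in X &, forall x y, radj x y}.
Proof.
split=> cX x y xX yX; last by move=> /negPf xy; have := cX x y xX yX; rewrite /radj xy.
by rewrite /radj; case: eqVneq => //= xy; apply: cX.
Qed.

Lemma clique_add x X : clique X -> complete x X -> clique (x |: X).
Proof.
move=> /cliqueE cX xX; apply/cliqueE => y z; rewrite !inE.
move=> /orP[/eqP->|yX] /orP[/eqP->|zX]; last exact: cX.
- exact: radj_refl.
- exact: xX.
- by rewrite radj_sym; apply: xX.
Qed.

Lemma clique_sub X Y : X \subset Y -> clique Y -> clique X.
Proof. by move=> /subsetP s cY x y /s xY /s yY; apply: cY. Qed.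

Lemma leq_omega X : clique X -> #|X| <= omega G.
Proof. by move=> /cliqueP cX; apply: (bigmax_sup X). Qed.

Lemma omega_del S :
  (forall X : {set G}, clique X -> [disjoint X & S] ->
     exists2 Y : {set G}, clique Y & #|X| + 2 <= #|Y|) ->
  omega (del S) + 2 <= omega G.
Proof.
move=> ext; suff h (Q : {set del S}) : @clique (del S) Q -> #|Q| + 2 <= omega G.
  (* The empty clique already extends by two, so the truncated subtraction [omega G - 2] is
     exact. *)
  have o2 : 2 <= omega G.
    have /h : @clique (del S) set0 by move=> x y; rewrite inE.
    by rewrite cards0.
  rewrite -(subnK o2) leq_add2r; apply/bigmax_leqP => Q /cliqueP/h le.
  by rewrite leq_subRL // addnC.
move=> cQ; have cX : clique (val @: Q : {set G}).
  move=> _ _ /imsetP[x xQ ->] /imsetP[y yQ ->] xy.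
  by apply: (cQ x y) => //; apply: contraNneq xy => ->.
have dX : [disjoint (val @: Q : {set G}) & S].
  apply/pred0P => x /=; apply/negbTE/andP => -[/imsetP[y _ ->]].
  by have := valP y; rewrite inE => /negPf ->.
have [Y cY le] := ext _ cX dX.
rewrite -(card_imset _ val_inj); apply: leq_trans le _; exact: leq_omega.
Qed.
End Cliques.

Lemma two_false (p : pred nat) : size (filter p [:: 1; 2; 3]) <= 1 ->
  exists c d, [/\ c != d, c \in [:: 1; 2; 3], d \in [:: 1; 2; 3],
    c \notin filter p [:: 1; 2; 3] & d \notin filter p [:: 1; 2; 3]].
Proof.
rewrite /=; case p1: (p 1); case p2: (p 2); case p3: (p 3) => //= _;
  by [exists 2, 3|exists 1, 3|exists 1, 2].
Qed.

(* How a component of a coloured class is represented: by any vertex, by the base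
   vertex [k], or by a vertex with the most neighbours in the classes of [U]. *)
Inductive rep := Any | Self of nat | Top of seq nat.

(* The [v k], k < n, are the base vertices, [kc k] the class of [v k], and [isT] the
   classes without neighbours in the core of the base.  The relations on classes
   are one-sided: [may] and [non] are the pairs not known to be complete or
   anticomplete, while [hom], [chain] and [tinc] record configurations known to be
   impossible. *)
Section Colouring.
Variables (G : sgraph) (v : nat -> G) (n : nat).
Variables (cl : G -> nat) (isT : pred nat).
Variables (may non hom : rel nat) (chain : nat -> nat -> nat -> bool).
Variables (bit : rel nat) (kc : nat -> nat) (tinc : bool -> nat -> nat -> nat -> bool).
Hypothesis may_ok : forall x y : G, radj x y -> may (cl x) (cl y).
Hypothesis non_ok : forall x y : G, ~~ radj x y -> non (cl x) (cl y).
Hypothesis hom_ok : forall w x y : G, hom (cl x) (cl y) -> cl w = cl x ->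
  radj w x -> radj x y -> radj w y.
Hypothesis chain_ok : forall x x' y z : G, chain (cl x) (cl y) (cl z) ->
  cl x' = cl x -> radj x x' -> radj x y -> radj x' z -> radj x' y || radj x z.
Hypothesis bit_ok : forall k (x : G), k < n -> radj x (v k) = bit k (cl x).
Hypothesis kc_ok : forall k, k < n -> cl (v k) = kc k.
Hypothesis tinc_ok : forall q x y : G, radj q x -> radj q y ->
  ~~ tinc (radj x y) (cl q) (cl x) (cl y).

Hypothesis T_trans : forall q r s : G, isT (cl q) -> isT (cl r) -> isT (cl s) ->
  radj q r -> radj r s -> radj q s.
Hypothesis T_hom : forall x q r : G, ~~ isT (cl x) -> isT (cl q) -> isT (cl r) ->
  radj q r -> radj x q -> radj x r.
Hypothesis T_nbr : forall q : G, isT (cl q) -> exists x y : G,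
  [/\ ~~ isT (cl x) /\ ~~ isT (cl y), radj q x, radj q y & ~~ radj x y].

Definition class_set i : {set G} := [set x | cl x == i].
Variable le : seq (nat * nat).
Hypothesis le_ok : forall k l, (k, l) \in le ->
  [/\ k < n, l < n & #|class_set (kc k)| <= #|class_set (kc l)|].

Variables (A TL : seq nat) (col : nat -> nat) (rp : nat -> rep).
Hypothesis A_ok : forall x : G, ~~ isT (cl x) -> cl x \in A.
Hypothesis A_T : {in A, forall i, ~~ isT i}.
Hypothesis TL_ok : forall x : G, isT (cl x) -> cl x \in TL.

Definition colours_ok := all (fun i => all (fun j =>
  [|| i == j, col i == 0, col i != col j | ~~ may i j]) A) A.
Hypothesis colours_okP : colours_ok.

(** [hom i i] makes the class P3-free, so its components are cliques. For [Top U] the chain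
    condition makes the neighbourhoods in [U] of two adjacent vertices of the class comparable. *)
Definition reprs_ok i := (col i == 0) ||
  [&& hom i i, col i < 4 & match rp i with
  | Any => true
  | Self k => (k < n) && (kc k == i)
  | Top U => all (fun u => all (chain i u) U) U
  end].
Hypothesis reprs_okP : all reprs_ok A.

Definition comp x := [set y | (cl y == cl x) && radj x y].
Definition score (U : seq nat) y := #|[set z | (cl z \in U) && radj y z]|.
(** The choice depends on [x] only through its class and the set [comp x], so it is constant on a
    component. As [x] belongs to [comp x], the default of [odflt] is never reached. *)
Definition repr_of x :=
  match rp (cl x) with
  | Any => odflt x [pick y in comp x]
  | Self k => v k
  | Top U => odflt x [pick y in comp x | [forall z in comp x, score U z <= score U y]]
  end.

Implicit Types (w x y z q : G) (X Y : {set G}).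

Lemma comp_refl x : x \in comp x.
Proof. by rewrite inE eqxx radj_refl. Qed.

Lemma col_hom x : ~~ isT (cl x) -> col (cl x) != 0 -> hom (cl x) (cl x).
Proof.
move=> /A_ok xA /negPf c0; have /allP/(_ _ xA) := reprs_okP.
by rewrite /reprs_ok c0 => /and3P[].
Qed.

Lemma comp_eq x y : ~~ isT (cl x) -> col (cl x) != 0 -> y \in comp x ->
  comp y = comp x.
Proof.
move=> xT c0; rewrite inE => /andP[/eqP yx xy]; have h := col_hom xT c0.
apply/setP => z; rewrite !inE yx; case: eqP => //= zx.
apply/idP/idP => [yz|xz].
- by apply: hom_ok xy yz; rewrite ?yx ?zx.
- by apply: (@hom_ok y x z); rewrite ?zx // radj_sym.
Qed.

Lemma repr_of_comp x : ~~ isT (cl x) -> col (cl x) != 0 -> repr_of x \in comp x.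
Proof.
move=> xT c0; have /allP/(_ _ (A_ok xT)) := reprs_okP.
rewrite /reprs_ok (negPf c0) /= => /and3P[_ _]; rewrite /repr_of.
case: (rp _) => [_|k /andP[kn /eqP kE]|U _].
- by case: pickP => [y //|/(_ x)]; rewrite comp_refl.
(* A vertex in the class of [v k] has the same trace as [v k], which is adjacent to itself in the
   closed sense; so the whole class is adjacent to [v k] and forms a single component. *)
- rewrite inE kc_ok // kE eqxx /= bit_ok //.
  by rewrite -kE -kc_ok // -bit_ok // radj_refl.
- by case: pickP => [y /andP[]//|_]; exact: comp_refl.
Qed.

Lemma repr_of_top x y U : ~~ isT (cl x) -> col (cl x) != 0 -> rp (cl x) = Top U ->
  y \in comp x -> score U y <= score U (repr_of x).
Proof.
move=> xT c0 e yx; rewrite /repr_of e; case: pickP => [z /andP[_ /forall_inP]|no] /=.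
  exact.
have [z zx zm] := @arg_maxnP _ x [in comp x] (score U) (comp_refl x).
have zx' : z \in comp x by [].
by have /negP[] := no z; rewrite zx'; apply/forall_inP.
Qed.

Lemma repr_of_eq x y : ~~ isT (cl x) -> col (cl x) != 0 -> y \in comp x ->
  repr_of y = repr_of x.
Proof.
move=> xT c0 yx; have ce := comp_eq xT c0 yx.
move: (yx); rewrite inE => /andP[/eqP yE _].
rewrite /repr_of yE ce; case: (rp _) => // [|U].
  by case: pickP => // /(_ x); rewrite comp_refl.
case: pickP => // no; have [z zx zm] := @arg_maxnP _ x [in comp x] (score U) (comp_refl x).
have zx' : z \in comp x by [].
by have /negP[] := no z; rewrite zx'; apply/forall_inP.
Qed.

Lemma repr_of_cl x : ~~ isT (cl x) -> col (cl x) != 0 -> cl (repr_of x) = cl x.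
Proof. by move=> xT c0; have := repr_of_comp xT c0; rewrite inE => /andP[/eqP]. Qed.

Lemma repr_of_radj x : ~~ isT (cl x) -> col (cl x) != 0 -> radj x (repr_of x).
Proof. by move=> xT c0; have := repr_of_comp xT c0; rewrite inE => /andP[]. Qed.

Definition repr_set c := [set x | [&& ~~ isT (cl x), col (cl x) == c & repr_of x == x]].

Lemma repr_of_set x : ~~ isT (cl x) -> col (cl x) != 0 -> repr_of x \in repr_set (col (cl x)).
Proof.
move=> xT c0; rewrite inE repr_of_cl // xT eqxx /=.
by rewrite (repr_of_eq xT c0) ?eqxx //; apply: repr_of_comp.
Qed.

Lemma repr_set_stable c : c != 0 -> {in repr_set c &, forall x y, radj x y -> x = y}.
Proof.
move=> c0 x y; rewrite !inE => /and3P[xT /eqP xc /eqP xr] /and3P[yT /eqP yc /eqP yr] xy.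
have /allP/(_ _ (A_ok xT))/allP/(_ _ (A_ok yT)) := colours_okP.
rewrite xc yc eqxx (negPf c0) may_ok //= orbF => /eqP e.
by rewrite -xr -yr (@repr_of_eq x y) // ?xc // inE e eqxx.
Qed.

Definition colored t := col t != 0.

(* In a clique X whose classes lie in [tau], the representative of the component
   of any x in X of class [t] is complete to X. *)
Definition dominating_in (t : nat) (tau : seq nat) := colored t &&
  match rp t with
  | Any => all (fun u => (u == t) || hom t u) tau
  | Self k => all (fun u => (u == t) || bit k u) tau
  | Top U => all (fun u => [|| u == t, hom t u | u \in U]) tau
  end.

(** Here X misses the class of [v k], so the representative of [v k] is outside X for free. [v k]
    itself is complete to X by its bits; the last condition carries this over to the
    representative. *)
Definition dominating_out (k : nat) (tau : seq nat) :=
  [&& colored (kc k), kc k \notin tau, ~~ isT (kc k), all (bit k) tau &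
  match rp (kc k) with
  | Any => all (fun u => ~~ non (kc k) u) tau
  | Self l => l == k
  | Top U => all (fun u => ~~ non (kc k) u || (u \in U)) tau
  end].

Definition classes_in X (tau : seq nat) := {in X, forall x, cl x \in tau}.

(** If the representative missed [y], then by nestedness its neighbourhood in [U] would be properly
    contained in that of [x], against its maximal score. *)
Lemma top_dom x U y : ~~ isT (cl x) -> colored (cl x) -> rp (cl x) = Top U ->
  cl y \in U -> radj x y -> radj (repr_of x) y.
Proof.
move=> xT c0 e yU xy; apply/negPn/negP => ny.
have := repr_of_top xT c0 e (comp_refl x).
rewrite /score leqNgt => /negP[].
apply/proper_card/properP; split; last by exists y; rewrite !inE yU ?xy // (negPf ny).
apply/subsetP => z; rewrite !inE => /andP[zU rz]; rewrite zU /=.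
have /allP/(_ _ (A_ok xT)) := reprs_okP.
rewrite /reprs_ok (negPf c0) e /= => /and3P[_ _ /allP/(_ _ yU)/allP/(_ _ zU) ch].
have := chain_ok ch (repr_of_cl xT c0) (repr_of_radj xT c0) xy rz.
by rewrite (negPf ny).
Qed.

Lemma dominating_inP x X tau : clique X -> classes_in X tau -> ~~ isT (cl x) -> x \in X ->
  dominating_in (cl x) tau -> complete (repr_of x) X.
Proof.
move=> /cliqueE cX cs xT xX /andP[c0 g] y yX.
have rx := repr_of_radj xT c0; have rc := repr_of_cl xT c0.
have xy := cX _ _ xX yX.
have [e|ne] := eqVneq (cl y) (cl x).
  have yx : y \in comp x by rewrite inE e eqxx.
  have := repr_of_comp xT c0; rewrite -(comp_eq xT c0 yx) inE => /andP[_].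
  by rewrite radj_sym.
move: g; case e: (rp _) => [|k|U] /allP/(_ _ (cs y yX)); rewrite (negPf ne) /=.
- by move=> h; apply: hom_ok xy; rewrite // radj_sym.
- move=> h; rewrite radj_sym /repr_of e bit_ok //.
  have /allP/(_ _ (A_ok xT)) := reprs_okP.
  by rewrite /reprs_ok (negPf c0) e /= => /and3P[_ _ /andP[]].
- case/orP => [h|yU]; first by apply: hom_ok xy; rewrite // radj_sym.
  exact: top_dom e yU xy.
Qed.

Lemma dominating_outP k X tau : classes_in X tau -> k < n -> dominating_out k tau ->
  complete (repr_of (v k)) X.
Proof.
move=> cs kn /and5P[c0 nt kT /allP bt g] y yX.
have xT : ~~ isT (cl (v k)) by rewrite kc_ok.
have c0' : colored (cl (v k)) by rewrite kc_ok.
have ky : radj (v k) y by rewrite radj_sym bit_ok ?bt ?cs.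
move: g; rewrite -kc_ok //; case e: (rp _) => [|l|U].
- move=> /allP/(_ _ (cs y yX)) nn.
  by apply: contraNT nn => /non_ok; rewrite repr_of_cl.
- by move=> /eqP lk; rewrite /repr_of e lk.
- move=> /allP/(_ _ (cs y yX)) /orP[nn|yU].
    by apply: contraNT nn => /non_ok; rewrite repr_of_cl.
  exact: top_dom e yU ky.
Qed.

Definition selfk k := if rp (kc k) is Self l then l == k else false.

(** The adjacency of [v k] and [v l] passes to their representatives if one of these is the base
    vertex itself, or if the two classes are complete to each other. *)
Definition two_outside (outs : seq nat) := has (fun k => has (fun l =>
  [&& bit k (kc l), kc k != kc l &
      [|| selfk k, selfk l | ~~ non (kc k) (kc l)]]) outs) outs.

(* For a pair (k, l) of [le] the class of [v k] is at most as large as that of [v l]: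
   the vertices of the first class are exchanged for the second class, a base vertex
   [v m], and a representative if X did not already miss one of the first class. *)
Definition swappable (tau : seq nat) := has (fun kl =>
  let k := kl.1 in let l := kl.2 in let rest := [seq u <- tau | u != kc k] in
  [&& kc k \in tau, ~~ isT (kc k), kc l \notin tau, all (fun u => ~~ non (kc l) u) (kc l :: rest),
   has (fun m => [&& kc m \notin tau, kc m != kc l & all (bit m) (kc l :: rest)]) (iota 0 n)
   & colored (kc k) || has (fun t => dominating_in t rest) rest]) le.

Definition extendable (tau : seq nat) :=
  let gin := [seq t <- tau | dominating_in t tau] in
  if 1 < size gin then true else
  let outs := [seq k <- iota 0 n | dominating_out k tau] in
  if (0 < size gin) && (0 < size outs) then true else
  if two_outside outs then true else swappable tau.

Definition Sall := repr_set 1 :|: repr_set 2 :|: repr_set 3.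

Lemma repr_of_Sall x : ~~ isT (cl x) -> colored (cl x) -> repr_of x \in Sall.
Proof.
move=> xT c0; have := repr_of_set xT c0.
have /allP/(_ _ (A_ok xT)) := reprs_okP.
rewrite /reprs_ok (negPf c0) /= => /and3P[_ lt _].
move: c0 lt; rewrite /colored /Sall !in_setU.
by case: (col _) => [|[|[|[|]]]] // _ _ ->; rewrite ?orbT.
Qed.

Lemma add2 p q X : clique X -> p \notin X -> q \notin X -> p != q ->
  complete p X -> complete q (p |: X) ->
  exists2 Y : {set G}, clique Y & #|X| + 2 <= #|Y|.
Proof.
move=> cX pX qX pq hp hq; exists (q |: (p |: X)).
  by apply: clique_add => //; apply: clique_add.
by rewrite !cardsU1 !inE (negPf qX) (negPf pX) eq_sym (negPf pq) /= addn2.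
Qed.

Lemma extendableP X tau : clique X -> [disjoint X & Sall] ->
  {subset tau <= A} -> uniq tau -> classes_in X tau ->
  {in tau, forall t, exists2 x, x \in X & cl x = t} ->
  extendable tau -> exists2 Y : {set G}, clique Y & #|X| + 2 <= #|Y|.
Proof.
move=> cX dX tA ut cs ex.
have tT t : t \in tau -> ~~ isT t by move=> /tA/A_T.
have inS x : ~~ isT (cl x) -> colored (cl x) -> repr_of x \notin X.
  move=> xT c0; apply/negP => h; have /pred0P/(_ (repr_of x))/= := dX.
  by rewrite h repr_of_Sall.
(* After the first representative [p] is added the classes still lie in [tau], so domination applies
   again to the larger clique; this gives the adjacency of the two new vertices as well. *)
have key x p : classes_in (p |: X) tau -> complete p X -> x \in X -> dominating_in (cl x) tau ->
    complete (repr_of x) (p |: X).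
  move=> cs' hp xX g; apply: dominating_inP g => //.
  - exact: clique_add.
  - exact/tT/cs.
  - by rewrite inE xX orbT.
have csr x : x \in X -> dominating_in (cl x) tau -> classes_in (repr_of x |: X) tau.
  move=> xX /andP[c0 _] y; rewrite !inE => /orP[/eqP->|/cs//].
  by rewrite repr_of_cl ?cs // tT ?cs.
rewrite /extendable; set gin := filter _ tau; set outs := filter _ (iota 0 n).
have gT x t : x \in X -> cl x = t -> t \in gin ->
    [/\ ~~ isT (cl x), colored (cl x), dominating_in (cl x) tau & complete (repr_of x) X].
  move=> xX <-; rewrite mem_filter => /andP[g _].
  split=> //; [exact/tT/cs|by case/andP: g|].
  by apply: dominating_inP g => //; apply/tT/cs.
have ex' t : t \in gin -> exists2 x, x \in X & cl x = t.
  by rewrite mem_filter => /andP[_ /ex].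
have outP k : k \in outs -> [/\ k < n, dominating_out k tau, ~~ isT (cl (v k)), colored (cl (v k)) &
     cl (repr_of (v k)) = kc k].
  rewrite mem_filter mem_iota add0n => /andP[g /andP[_ kn]].
  have /and5P[c0 _ kT _ _] := g.
  by split=> //; rewrite ?kc_ok // repr_of_cl kc_ok.
case: ifP => [big _|_].
  have [t [u [tg ug tu]]] : exists t u, [/\ t \in gin, u \in gin & t != u].
    have gu : uniq gin by apply: filter_uniq.
    exists (nth 0 gin 0), (nth 0 gin 1); rewrite !mem_nth //; last exact: ltnW.
    by split=> //; rewrite nth_uniq // ltnW.
  have [x xX xt] := ex' t tg; have [y yX yu] := ex' u ug.
  have [xT xc xg xp] := gT x t xX xt tg; have [yT yc yg yp] := gT y u yX yu ug.
  apply: (@add2 (repr_of x) (repr_of y)) => //; try exact: inS.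
  - apply: contra_neq tu => e.
    by rewrite -xt -yu -(repr_of_cl xT xc) -(repr_of_cl yT yc) e.
  - by apply: key => //; apply: csr.
case: ifP => [/andP[gn on] _|_].
  have [t tg] : exists t, t \in gin by exists (nth 0 gin 0); apply: mem_nth.
  have [k kg] : exists k, k \in outs by exists (nth 0 outs 0); apply: mem_nth.
  have [x xX xt] := ex' t tg; have [xT xc xg xp] := gT x t xX xt tg.
  have [kn ko kT kcol kE] := outP k kg.
  apply: (@add2 (repr_of x) (repr_of (v k))) => //; try exact: inS.
  - have /and5P[_ nt _ _ _] := ko; apply: contraNneq nt => e.
    by rewrite -kE -e repr_of_cl ?cs.
  - by apply: dominating_outP ko => //; apply: csr.
case: ifP => [/hasP[k kg /hasP[l lg /and3P[bkl kl sf]]] _|_].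
  have [kn ko kT kcol kE] := outP k kg; have [ln lo lT lcol lE] := outP l lg.
  apply: (@add2 (repr_of (v k)) (repr_of (v l))) => //; try exact: inS.
  - by apply: contra_neq kl => e; rewrite -kE -lE e.
  - exact: dominating_outP ko.
  - move=> y; rewrite !inE => /orP[/eqP->|yX]; last by apply: dominating_outP yX; first exact: cs.
    have self m : m < n -> selfk m -> repr_of (v m) = v m.
      by move=> mn; rewrite /selfk /repr_of kc_ok //; case: (rp _) => // ? /eqP ->.
    case/or3P: sf => [/(self _ kn) ->|/(self _ ln) ->|nn].
    + by rewrite bit_ok // lE.
    + rewrite radj_sym bit_ok // kE -kc_ok // -bit_ok // radj_sym bit_ok //.
      by rewrite kc_ok.
    + by rewrite radj_sym; apply: contraNT nn => /non_ok; rewrite kE lE.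
move=> /hasP[[k l] kle].
rewrite /fst /snd => /and5P[kt kT lt /allP nl /andP[/hasP[m mI /and3P[mt ml /allP bm]] alt]].
have [kn ln card] := le_ok kle.
set rest := [seq u <- tau | u != kc k] in nl bm alt.
have cE : {in X &, forall x y, radj x y} by apply/cliqueE.
(* The exchange: the class of [v k] leaves X, and the whole class of [v l], a clique that X does not
   meet, enters. *)
pose X1 := X :\: class_set (kc k).
have cs1 : classes_in X1 rest.
  by move=> x; rewrite !inE mem_filter => /andP[-> /cs ->].
have cX1 : clique X1 by apply: clique_sub cX; apply: subsetDl.
have lX x : x \in X -> cl x != kc l.
  by move=> /cs xt; apply: contraNneq lt => <-.
have l1 x y : cl x = kc l -> cl y \in kc l :: rest -> radj x y.
  move=> xl yr; apply/negPn/negP => /non_ok; rewrite xl.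
  by move/negP: (nl _ yr).
have mem1 x : x \in X1 -> cl x \in kc l :: rest by move=> /cs1; rewrite inE orbC => ->.
pose X2 := class_set (kc l) :|: X1.
have mem2 x : x \in X2 -> cl x \in kc l :: rest.
  by rewrite !inE => /orP[->//|h]; rewrite cs1 ?orbT // !inE.
have cX2 : clique X2.
  apply/cliqueE => x y xX yX; move: (xX) (yX); rewrite /X2 ![_ \in _ :|: _]inE ![_ \in class_set _]inE.
  move=> /orP[/eqP xl _|xX1 /orP[/eqP yl|yX1]].
  - by apply: l1 => //; apply: mem2.
  - by rewrite radj_sym; apply: l1 => //; apply: mem2.
  - by apply: cE; move: xX1 yX1; rewrite !inE => /andP[_ ?] /andP[_ ?].
have [mn mt' ml' bm'] : [/\ m < n, kc m \notin tau, kc m != kc l & complete (v m) X2].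
  have mn : m < n by move: mI; rewrite mem_iota.
  by split=> // y /mem2 yr; rewrite radj_sym bit_ok ?bm.
have dj : #|X2| = #|class_set (kc l)| + #|X1|.
  rewrite cardsU; suff -> : class_set (kc l) :&: X1 = set0 by rewrite cards0 subn0.
  apply/setP => x; rewrite !inE; apply/negbTE/and3P => -[/eqP xl _ /lX].
  by rewrite xl eqxx.
have vmX : v m \notin X2.
  rewrite !inE kc_ok // (negPf ml') /=; apply/andP => -[_ /cs].
  by rewrite kc_ok // (negPf mt').
have cY0 : clique (v m |: X2) by apply: clique_add.
have cY : #|v m |: X2| = (#|class_set (kc l)| + #|X1|).+1 by rewrite cardsU1 vmX dj.
have sX : #|X| = #|X :&: class_set (kc k)| + #|X1| by rewrite cardsID.
(* The exchange loses nothing and [v m] gains one vertex. If the class of [v k] is coloured, X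
   missed its representative, so the exchange itself gains another; otherwise a dominating
   representative supplies it. *)
case/orP: alt => [ck|/hasP[t trest gt]].
  exists (v m |: X2) => //; rewrite cY sX addn2 ltnS -addSn leq_add2r.
  apply: leq_trans card; apply/proper_card/properP; split; first exact: subsetIr.
  have c1 : colored (cl (v k)) by rewrite kc_ok.
  have T1 : ~~ isT (cl (v k)) by rewrite kc_ok.
  exists (repr_of (v k)); first by rewrite inE repr_of_cl // kc_ok.
  by rewrite inE (negPf (inS _ T1 c1)).
have [tt tk] : t \in tau /\ t != kc k by move: trest; rewrite mem_filter => /andP[].
have [x xX xt] := ex t tt.
have xX1 : x \in X1 by rewrite !inE xt tk.
have xT : ~~ isT (cl x) by rewrite xt tT.
have c0 : colored (cl x) by rewrite xt; case/andP: gt.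
have rX : repr_of x \notin v m |: X2.
  rewrite !inE repr_of_cl // (negPf (inS _ xT c0)) andbF orbF negb_or (negPf (lX _ xX)) andbT.
  apply: contraNneq mt => e; rewrite -kc_ok // -e repr_of_cl // xt //.
exists (repr_of x |: (v m |: X2)).
  apply: clique_add => // y; rewrite in_setU1 /X2 in_setU => /or3P[/eqP->|yl|yX1].
  - rewrite bit_ok // repr_of_cl // xt bm // inE trest orbT //.
  - rewrite radj_sym; apply: l1; first by move: yl; rewrite inE => /eqP.
    by rewrite repr_of_cl // xt inE trest orbT.
  - by apply: (dominating_inP cX1 cs1) yX1; rewrite // xt.
rewrite cardsU1 rX cY sX addn2 add1n !ltnS leq_add2r.
by apply: leq_trans card; apply/subset_leq_card/subsetIr.
Qed.

(* Enumerates the sets of classes that can meet a clique. *)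
Fixpoint every_class_set (good : seq nat -> bool) (m : nat) (tau cand : seq nat) : bool :=
  match cand, m with
  | [::], _ => good tau
  | i :: cand', m'.+1 =>
    every_class_set good m' (i :: tau) [seq j <- cand' | may i j && all (fun t => ~~ tinc true t i j) tau]
    && every_class_set good m' tau cand'
  | _, 0 => false
  end.

(** [P] stands for the classes met by a clique. The branch that takes exactly the candidates in [P]
    is never pruned, so its leaf has been tested. Exhausted fuel counts as failure, hence no bound
    on [m]. *)
Lemma every_class_setP good (P : pred nat) m tau cand :
  {in P &, forall i j, may i j} ->
  {in P & &, forall t i j, ~~ tinc true t i j} ->
  {subset tau <= P} -> uniq (tau ++ cand) -> every_class_set good m tau cand ->
  exists tau', [/\ good tau', uniq tau' & tau' =i tau ++ filter P cand].
Proof.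
move=> Pm Pt; elim: m tau cand => [|m IH] tau [|i cand] //= tP ut.
- by move=> g; exists tau; split=> //; move: ut; rewrite cats0.
- by move=> g; exists tau; split=> //; move: ut; rewrite cats0.
case/andP => h1 h2; case Pi: (P i); last first.
  apply: IH h2 => //; move: ut; rewrite !cat_uniq /= => /and3P[-> h /andP[_ ->]].
  by rewrite andbT; move: h; rewrite negb_or => /andP[].
case: (IH _ _ _ _ h1) => [t|//=|tau' [g u e]].
- by rewrite inE => /orP[/eqP->|/tP].
- move: ut; rewrite -cat1s uniq_catCA /= => /andP[h u2].
  rewrite (subseq_uniq _ u2) ?andbT; last by rewrite cat_subseq ?filter_subseq.
  apply: contra h; rewrite !mem_cat => /orP[->//|].
  by rewrite mem_filter orbC => /andP[_ ->].
exists tau'; split=> // t; rewrite e !inE !mem_cat inE orbCA; congr (_ || (_ || _)).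
rewrite !mem_filter; case Ptt: (t \in P); last by rewrite -[P t]/(t \in P) Ptt.
rewrite -[P t]/(t \in P) Ptt /=.
rewrite (Pm i t Pi Ptt) /=; suff -> : all (fun t0 => ~~ tinc true t0 i t) tau by [].
by apply/allP => t0 /tP Pt0; apply: Pt.
Qed.

(** * Greedy colouring of the vertices without neighbours in the core *)

Definition never_both k a b := tinc true k a b && tinc false k a b.
(** By [T_nbr] a coreless vertex has two nonadjacent neighbours in classes of [A]; a coreless class
    where the tables exclude this is empty. *)
Definition live k := has (fun a => may k a &&
  has (fun b => [&& may k b, non a b & ~~ tinc false k a b]) A) A.
Definition has_dominating k tau := has (fun t => dominating_in t tau &&
  (hom t k || if rp t is Self m then bit m k else false)) tau.
(** No vertex of class [k] sees representatives of all three colours, so its component has a colour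
    available. *)
Definition colour_left k :=
  let cs c := [seq a <- A | (col a == c) && may k a] in
  all (fun a => all (fun b => never_both k a b ||
    all (fun c => never_both k a c || never_both k b c) (cs 3)) (cs 2)) (cs 1).
(** For a vertex of class [k] in a clique meeting the classes [tau], at most one of the three
    colours is blocked. *)
Definition two_colours_left k tau :=
  let cs := [seq a <- A | [&& colored a, may k a & all (fun s => ~~ never_both k s a) tau]] in
  all (fun a => all (fun b => (col a == col b) || never_both k a b) cs) cs.
(** Let a clique avoid the three stable sets and contain [q] of class [k]. The component of [q] has
    a coloured vertex, which is one gain. The other is a neighbour of [q] if the clique is entirely
    coreless, a dominating representative adjacent to the component, or a second coloured vertex of
    the component. *)
Definition extendableT k := colour_left k &&
  every_class_set (fun tau => [|| tau == [::], has_dominating k tau | two_colours_left k tau]) (size A) [::]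
    [seq a <- A | may k a].

Definition T_comp q := [set r | isT (cl r) && radj q r].
Definition avail q :=
  [seq c <- [:: 1; 2; 3] | [forall s, (s \in repr_set c) ==> ~~ radj s q]].
(** The i-th vertex of a component gets its i-th available colour. A component is a homogeneous
    clique, so [avail] is the same for all of its vertices; the default 0 of [nth] leaves the
    remaining ones uncoloured. *)
Definition T_set c := [set q | isT (cl q) &&
  (nth 0 (avail q) (index q (enum (T_comp q))) == c)].

Lemma T_comp_eq q r : isT (cl q) -> r \in T_comp q -> T_comp r = T_comp q.
Proof.
move=> qT; rewrite inE => /andP[rT qr]; apply/setP => s; rewrite !inE.
case sT: (isT (cl s)) => //=; apply/idP/idP => h.
  exact: T_trans qr h.
by apply: (@T_trans r q s); rewrite // radj_sym.
Qed.

Lemma avail_eq q r : isT (cl q) -> r \in T_comp q -> avail r = avail q.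
Proof.
move=> qT; rewrite inE => /andP[rT qr]; apply: eq_in_filter => c _.
apply: eq_forallb => s; case sS: (s \in repr_set c) => //=; congr (~~ _).
move: sS; rewrite inE => /and3P[sT _ _].
apply/idP/idP => h; last exact: T_hom qr h.
by apply: T_hom h; rewrite // radj_sym.
Qed.

Definition colour_set c := repr_set c :|: T_set c.

Lemma colour_set_stable c : c != 0 -> stable (colour_set c).
Proof.
move=> c0; have key x y : x \in colour_set c -> y \in colour_set c -> radj x y -> x = y.
  have mixed s q : s \in repr_set c -> q \in T_set c -> ~~ radj s q.
    move=> sS; rewrite inE => /andP[qT /eqP e].
    have : c \in avail q.
      rewrite -e mem_nth // ltnNge; apply/negP => h.
      by move: c0; rewrite -e nth_default.
    by rewrite mem_filter => /andP[/forallP/(_ s)/implyP/(_ sS)].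
  rewrite ![_ \in colour_set _]inE => /orP[xS|xT] /orP[yS|yT] xy.
  - exact: (repr_set_stable c0 xS yS xy).
  - by case/negP: (mixed _ _ xS yT).
  - by case/negP: (mixed _ _ yS xT); rewrite radj_sym.
  move: xT yT; rewrite !inE => /andP[xT /eqP xc] /andP[yT /eqP yc].
  have yx : y \in T_comp x by rewrite inE yT.
  have xx : x \in T_comp x by rewrite inE xT radj_refl.
  move: yc; rewrite (T_comp_eq xT yx) (avail_eq xT yx) => yc.
  have sz r : nth 0 (avail x) r = c -> r < size (avail x).
    by move=> e; rewrite ltnNge; apply/negP => h; move: c0; rewrite -e nth_default.
  have ua : uniq (avail x) by apply: filter_uniq.
  have /eqP := etrans xc (esym yc); rewrite nth_uniq ?sz // => /eqP e.
  have xe : x \in enum (T_comp x) by rewrite mem_enum.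
  by rewrite -(nth_index x xe) e nth_index ?mem_enum.
move=> x y xS yS; apply/negP => xy.
have e : x = y by apply: key; rewrite // /radj xy orbT.
by rewrite e adj_irr in xy.
Qed.

Lemma colour_set_disjoint c d : c != d -> [disjoint colour_set c & colour_set d].
Proof.
move=> cd; apply/pred0P => x /=; rewrite !inE.
case: (isT _) => //=; rewrite ?orbF.
  by apply/negbTE/andP => -[/eqP e1 /eqP e2]; case/eqP: cd; rewrite -e1.
apply/negbTE/andP => -[/andP[/eqP e1 _] /andP[/eqP e2 _]].
by case/eqP: cd; rewrite -e1.
Qed.

Hypothesis uA : uniq A.
Hypothesis chkA : every_class_set extendable (size A) [::] A.
Hypothesis chkT : all (fun k => ~~ live k || extendableT k) TL.

Definition Sfull := colour_set 1 :|: colour_set 2 :|: colour_set 3.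

Lemma live_T q : isT (cl q) -> live (cl q).
Proof.
move=> /T_nbr[x [y [[xT yT] qx qy xy]]].
apply/hasP; exists (cl x); first exact: A_ok.
rewrite may_ok //=; apply/hasP; exists (cl y); first exact: A_ok.
rewrite may_ok // non_ok //=.
by have := tinc_ok qx qy; rewrite (negPf xy).
Qed.

Lemma extendableT_cl q : isT (cl q) -> extendableT (cl q).
Proof.
by move=> qT; have /allP/(_ _ (TL_ok qT)) := chkT; rewrite live_T.
Qed.

Lemma never_bothP q x y : radj q x -> radj q y -> ~~ never_both (cl q) (cl x) (cl y).
Proof.
move=> qx qy; have := tinc_ok qx qy; rewrite /never_both negb_and.
by case: (radj x y) => ->; rewrite ?orbT.
Qed.

Lemma extend_clique X : clique X -> [disjoint X & Sfull] ->
  exists2 Y : {set G}, clique Y & #|X| + 2 <= #|Y|.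
Proof.
move=> cX dX; have cE : {in X &, forall x y, radj x y} by apply/cliqueE.
pose P := [pred i | [exists x in X, (cl x == i) && ~~ isT (cl x)]].
have PP i : i \in P -> exists2 x, x \in X & cl x = i /\ ~~ isT (cl x).
  by move=> /exists_inP[x xX /andP[/eqP e xT]]; exists x.
have Pcl x : x \in X -> ~~ isT (cl x) -> cl x \in P.
  by move=> xX xT; apply/exists_inP; exists x; rewrite // eqxx.
have Pm : {in P &, forall i j, may i j}.
  by move=> i j /PP[x xX [<- _]] /PP[y yX [<- _]]; apply/may_ok/cE.
have Pt : {in P & &, forall t i j, ~~ tinc true t i j}.
  move=> t i j /PP[x xX [<- _]] /PP[y yX [<- _]] /PP[z zX [<- _]].
  by have := tinc_ok (cE _ _ xX yX) (cE _ _ xX zX); rewrite cE.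
have dS : [disjoint X & Sall].
  apply: disjointWr dX; apply/subsetP => z; rewrite !inE.
  by case/orP => [/orP[]|] ->; rewrite ?orbT.
have [q0|[q qX qT]] : (forall q, q \in X -> ~~ isT (cl q)) \/
    (exists2 q, q \in X & isT (cl q)).
  case: (boolP [exists q in X, isT (cl q)]) => [/exists_inP|]; first by right.
  by move=> /exists_inPn h; left.
- case: (every_class_setP Pm Pt _ _ chkA) => // tau [g u e].
  have e' t : (t \in tau) = (t \in P) && (t \in A) by rewrite e mem_filter.
  apply: (extendableP (tau := tau)) => // [t|x xX|t].
  + by rewrite e' => /andP[].
  + by rewrite e' Pcl ?q0 // A_ok ?q0.
  + by rewrite e' => /andP[/PP[x xX [<- _]] _]; exists x.
have /andP[c3 ck] := extendableT_cl qT.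
have avP c : c \in [:: 1; 2; 3] -> c \notin avail q ->
    exists s, [/\ s \in repr_set c, radj q s, cl s \in A & may (cl q) (cl s)].
  move=> cc; rewrite mem_filter cc andbT negb_forall => /existsP[s].
  rewrite negb_imply negbK => /andP[sS sq]; exists s; rewrite radj_sym; split=> //.
    by move: sS; rewrite inE => /and3P[sT _ _]; apply: A_ok.
  by apply: may_ok; rewrite radj_sym.
have S0c c s : s \in repr_set c -> col (cl s) = c by rewrite inE => /and3P[_ /eqP].
have av1 : avail q != [::].
  apply/negP => /eqP e.
  have [//||a [aS qa aA ma]] := avP 1; first by rewrite e.
  have [//||b [bS qb bA mb]] := avP 2; first by rewrite e.
  have [//||c [cS qc cA mc]] := avP 3; first by rewrite e.
  have mem s d : s \in repr_set d -> cl s \in A -> may (cl q) (cl s) ->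
      cl s \in [seq a <- A | (col a == d) && may (cl q) a].
    by move=> sS sA ms; rewrite mem_filter (S0c _ _ sS) eqxx ms.
  have np x y : radj q x -> radj q y -> never_both (cl q) (cl x) (cl y) = false.
    by move=> qx qy; apply/negbTE/never_bothP.
  have /allP/(_ _ (mem _ _ aS aA ma))/allP/(_ _ (mem _ _ bS bA mb)) := c3.
  rewrite np //= => /allP/(_ _ (mem _ _ cS cA mc)).
  by rewrite !np.
have SQ j : j < size (avail q) -> j < #|T_comp q| ->
    nth q (enum (T_comp q)) j \in T_comp q /\ nth q (enum (T_comp q)) j \notin X.
  rewrite cardE => ja jQ; have pQ : nth q (enum (T_comp q)) j \in T_comp q.
    by rewrite -mem_enum mem_nth.
  split=> //; apply/negP => pX; have /pred0P/(_ (nth q (enum (T_comp q)) j))/= := dX.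
  rewrite pX /=; suff -> : nth q (enum (T_comp q)) j \in Sfull by [].
  have : nth 0 (avail q) j \in avail q by apply: mem_nth.
  rewrite mem_filter => /andP[_]; have pT : isT (cl (nth q (enum (T_comp q)) j)).
    by move: pQ; rewrite inE => /andP[].
  have : nth q (enum (T_comp q)) j \in T_set (nth 0 (avail q) j).
    by rewrite inE pT (avail_eq qT pQ) (T_comp_eq qT pQ) index_uniq ?enum_uniq ?eqxx.
  by rewrite !in_cons orbF => h /or3P[] /eqP e; move: h;
    rewrite e /Sfull /colour_set !in_setU => ->; rewrite ?orbT.
have qQ : q \in T_comp q by rewrite inE qT radj_refl.
(* The coreless vertices of X belong to the component of [q], which is a clique; the others do not
   distinguish its vertices. *)
have full p : p \in T_comp q -> complete p X.
  rewrite inE => /andP[pT qp] y yX; have yq := cE _ _ yX qX.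
  have [yT|yT] := boolP (isT (cl y)).
    by apply: (@T_trans p q y); rewrite // radj_sym.
  by rewrite radj_sym; apply: T_hom qp yq.
have Q1 : 0 < #|T_comp q| by apply/card_gt0P; exists q.
have a1 : 0 < size (avail q) by rewrite lt0n size_eq0.
have [p0Q p0X] := SQ 0 a1 Q1; set p0 := nth q _ 0 in p0Q p0X.
(* [q] lies in X and [p0] does not. *)
have Q2 : 1 < #|T_comp q|.
  rewrite (cardsD1 q) qQ ltnS; apply/card_gt0P; exists p0; rewrite inE p0Q andbT.
  by rewrite inE; apply: contraNneq p0X => ->.
have [a2|a2] := ltnP 1 (size (avail q)).
  have [p1Q p1X] := SQ 1 a2 Q2; set p1 := nth q _ 1 in p1Q p1X.
  apply: (@add2 p0 p1) => //; first by rewrite nth_uniq ?enum_uniq // -cardE.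
    exact: full.
  move=> y; rewrite in_setU1 => /orP[/eqP->|]; last exact: full.
  move: p0Q p1Q; rewrite !inE => /andP[? ?] /andP[? ?].
  by apply: (@T_trans p1 q p0); rewrite // radj_sym.
(* With a single available colour, [p0] has to be accompanied by a vertex that is not coreless;
   adjacency to [q] suffices for adjacency to [p0]. *)
have addx x : ~~ isT (cl x) -> radj x q -> x \notin X -> complete x X ->
    exists2 Y : {set G}, clique Y & #|X| + 2 <= #|Y|.
  move=> xT xq xX cx; apply: (@add2 p0 x) => //; last 2 first.
  - exact: full.
  - move=> y; rewrite in_setU1 => /orP[/eqP->|]; last exact: cx.
    by move: p0Q; rewrite inE => /andP[? ?]; apply: T_hom xq.
  - by apply: contraNneq xT => <-; move: p0Q; rewrite inE => /andP[].
case: (every_class_setP Pm Pt _ _ ck) => //=; first exact: filter_uniq.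
move=> tau [good _ e].
have mtau x : x \in X -> ~~ isT (cl x) -> cl x \in tau.
  move=> xX xT; rewrite e mem_filter; apply/andP; split; first exact: Pcl.
  by rewrite mem_filter A_ok // may_ok // cE.
have ext t : t \in tau -> exists2 x, x \in X & cl x = t /\ ~~ isT (cl x).
  by rewrite e mem_filter => /andP[tP _]; apply: PP.
case/or3P: good => [/eqP t0|/hasP[t tt /andP[g ht]]|c2].
- have [x [_ [[xT _] qx _ _]]] := T_nbr qT.
  have allT y : y \in X -> isT (cl y).
    by move=> yX; apply/negPn/negP => /(mtau _ yX); rewrite t0.
  apply: (addx x) => //; first by rewrite radj_sym.
    by apply: contra xT; apply: allT.
  move=> y yX; apply: (@T_hom x q y) => //; first exact: allT.
    exact: cE.
  by rewrite radj_sym.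
- have [x xX [xt xT]] := ext t tt.
  have c0 : colored (cl x) by rewrite xt; case/andP: g.
  have rT : ~~ isT (cl (repr_of x)) by rewrite repr_of_cl.
  have rq : radj (repr_of x) q.
    case/orP: ht => [ht|]; last first.
      rewrite -xt /repr_of; have /allP/(_ _ (A_ok xT)) := reprs_okP.
      rewrite /reprs_ok (negPf c0) /=; case: (rp _) => // m /and3P[_ _ /andP[mn _]] bm.
      by rewrite radj_sym bit_ok.
    apply: (@hom_ok (repr_of x) x q); rewrite ?xt // -?xt ?repr_of_cl //.
      by rewrite radj_sym repr_of_radj.
    exact: cE.
  apply: (addx (repr_of x)) => //.
    apply/negP => h; have /pred0P/(_ (repr_of x))/= := dS.
    by rewrite h repr_of_Sall.
  move=> y yX; have [yT|yT] := boolP (isT (cl y)).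
    by apply: (@T_hom (repr_of x) q y) => //; apply: cE.
  apply: (dominating_inP (X := [set z in X | ~~ isT (cl z)]) (tau := tau)); rewrite ?xt ?inE ?xX ?yX // -?xt //.
    by apply: clique_sub cX; apply/subsetP => z; rewrite inE => /andP[].
  by move=> z; rewrite inE => /andP[zX zT]; apply: mtau.
(* Two colours are blocked, each by a representative adjacent to [q], which [two_colours_left]
   excludes. *)
have [c [d [cd cc dd cn dn]]] : exists c d, [/\ c != d, c \in [:: 1; 2; 3],
    d \in [:: 1; 2; 3], c \notin avail q & d \notin avail q].
  apply: (@two_false (fun c => [forall s, (s \in repr_set c) ==> ~~ radj s q])).
  by rewrite -ltnS.
have [a [aS qa aA ma]] := avP c cc cn.
have [b [bS qb bA mb]] := avP d dd dn.
have c123 (x : nat) : x \in [:: 1; 2; 3] -> x != 0 by case: x.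
have mem s (x : nat) : x != 0 -> s \in repr_set x -> radj q s -> cl s \in A -> may (cl q) (cl s) ->
    cl s \in [seq a <- A | [&& colored a, may (cl q) a & all (fun s => ~~ never_both (cl q) s a) tau]].
  move=> x0 sS qs sA ms; rewrite mem_filter sA ms /colored (S0c _ _ sS) x0 /= andbT.
  by apply/allP => u /ext[y yX [<- yT]]; apply: never_bothP => //; apply: cE.
have /allP/(_ _ (mem _ _ (c123 _ cc) aS qa aA ma))/allP/(_ _ (mem _ _ (c123 _ dd) bS qb bA mb)) := c2.
by rewrite (S0c _ _ aS) (S0c _ _ bS) (negPf cd) (negPf (never_bothP qa qb)).
Qed.

Lemma nice_of_colouring : nice G.
Proof.
exists (colour_set 1), (colour_set 2), (colour_set 3); split.
- by split; apply: colour_set_stable.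
- by split; apply: colour_set_disjoint.
- exact: omega_del extend_clique.
Qed.
End Colouring.

(** * Certificates *)

(* The base is given with its core as the last [c_core] vertices, [c_types] are the
   possible traces on it, and classes are indices into [c_types].  A code 0 claims
   nothing and a code k+1 refers to the kth avoided pattern: in row i, column
   j <= i, of [c_adj] ([c_non]) it says that an adjacent (nonadjacent) pair of these
   classes produces that pattern.  An entry (i, j, k) of [c_hom] similarly excludes
   w, x of class i and y of class j with path w-x-y, an entry (i, u, v, (k1, k0)) of
   [c_chain] excludes a path y-x-x'-z with x, x' of class i, with or without the edge
   y-z, and an entry (a, b, k) in row q of [c_tri e] excludes x, y of classes a, b
   adjacent to a vertex of class q, where e is the adjacency of x and y.  A member of
   [c_sols] consists of forbidden classes, colours (0 = none) and representatives. *)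
Record cert := Cert {
  c_base : bmatrix;
  c_core : nat;
  c_types : bmatrix;
  c_adj : seq (seq nat);
  c_non : seq (seq nat);
  c_hom : seq (nat * nat * nat);
  c_chain : seq (nat * nat * nat * (nat * nat));
  c_tri : bool -> seq (seq (nat * nat * nat));
  c_le : seq (nat * nat);
  c_sols : seq (seq nat * seq nat * seq rep);
  c_leaf : seq nat }.

Definition get (M : seq (seq nat)) i j :=
  if i <= j then nth 0 (nth [::] M j) i else nth 0 (nth [::] M i) j.

Section Check.
Variables (pats : seq bmatrix) (c : cert) (Hb : bmatrix) (kcs : seq nat).
Let typ i := nth [::] (c_types c) i.
Let N := size (c_types c).
Let n := size (c_base c).

Definition refuted k f H :=
  if k is k'.+1 then
    if k' < size pats then found f (nth [::] pats k') H else false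
  else false.

Definition may_table i j := get (c_adj c) i j == 0.
Definition non_table i j := get (c_non c) i j == 0.
Definition hom_table i j :=
  if non_table i j then has (fun t => t.1 == (i, j)) (c_hom c) else true.
Definition chain_table i u v := has (fun t => t.1 == (i, minn u v, maxn u v)) (c_chain c).
Definition tinc_table (e : bool) q a b :=
  if (if e then may_table a b else non_table a b) then
    has (fun t => t.1 == (minn a b, maxn a b)) (nth [::] (c_tri c e) q)
  else true.
Definition bit k i := nth false (typ i) k.
Definition kc k := nth 0 kcs k.
Definition coreless i := ~~ has id (drop (n - c_core c) (typ i)).

Definition host1 i := extend (typ i) Hb.
Definition host2 e i j := extend (e :: typ i) (host1 j).
Definition host3 e1 e2 e3 i j k := extend [:: e1, e2 & typ i] (host2 e3 j k).
Definition host4 e1 e2 e3 e4 e5 e6 i j k l :=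
  extend [:: e1, e2, e3 & typ i] (host3 e4 e5 e6 j k l).

Definition pairs_ok_in e M := all (fun i => all (fun j =>
  let k := get M i j in
  if k == 0 then true else refuted k 2 (host2 e i j)) (iota 0 i.+1)) (iota 0 N).
Definition hom_ok_in := all (fun t =>
  refuted t.2 3 (host3 true false true t.1.1 t.1.1 t.1.2)) (c_hom c).
Definition chain_ok_in := all (fun t =>
  let: (i, u, v, (k1, k0)) := t in
  (if may_table u v then refuted k1 4 (host4 true false true true false true i i u v) else true) &&
  (if non_table u v then refuted k0 4 (host4 true false true true false false i i u v) else true))
  (c_chain c).
Definition triples_ok_in e := all (fun q => all (fun t =>
  refuted t.2 3 (host3 true true e q t.1.1 t.1.2)) (nth [::] (c_tri c e) q)) (iota 0 N).

Fixpoint tails (p : bmatrix) : seq bmatrix := if p is r :: p' then rcons (tails p') p else [::].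

Fixpoint has_found f (ps : seq bmatrix) H :=
  if ps is p :: ps' then if found f p H then true else has_found f ps' H else false.

(* [ts] lists the reversed ends, still to be read, of the types extending [m]. *)
Definition covers_step (rec : seq bool -> seq (seq bool) -> bool) s m ts b :=
  let ts' := [seq behead t | t <- ts & head (~~ b) t == b] in
  let m' := b :: m in
  if ts' is [::] then
    if has_found 2 pats (extend m' (full s)) then true else rec m' ts'
  else rec m' ts'.

(** Traces are explored bit by bit from the last base vertex, and a branch that no listed type
    continues is cut as soon as an avoided pattern appears. This avoids a test of all masks on the
    base. *)
Fixpoint covers (ss : seq bmatrix) (m : seq bool) (ts : seq (seq bool)) : bool :=
  if ss is s :: ss' then
    if covers_step (covers ss') s m ts true then covers_step (covers ss') s m ts false
    else false
  else ts != [::].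

Definition types_ok_in := all (fun t => size t == n) (c_types c) &&
  covers (tails (c_base c)) [::] [seq rev t | t <- c_types c].

Fixpoint vectors i (cs : seq nat) : seq (seq bool) :=
  if cs is j :: cs' then
    let vs := vectors i cs' in
    (if may_table i j then [seq true :: v | v <- vs] else [::]) ++
    (if non_table i j then [seq false :: v | v <- vs] else [::])
  else [:: [::]].

(* Whether no choice of one class in each member of [rems] can be realized
   simultaneously, so that some member of [c_sols] applies. *)
Fixpoint unreal (rems : seq (seq nat)) (cs : seq nat) H : bool :=
  match rems with
  | [::] => has (fun k => refuted k 0 H) (c_leaf c)
  | r :: rems' => all (fun i =>
      if i \in cs then unreal rems' cs H
      else all (fun v => unreal rems' (i :: cs) (extend (v ++ typ i) H)) (vectors i cs)) r
  end.

Definition colouring_ok (s : seq nat * seq nat * seq rep) :=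
  let A := [seq i <- iota 0 N | ~~ coreless i && (i \notin s.1.1)] in
  let TL := [seq i <- iota 0 N | coreless i] in
  let col := nth 0 s.1.2 in
  let rp := nth Any s.2 in
  [&& colours_ok may_table A col,
      all (reprs_ok n hom_table chain_table kc col rp) A,
      every_class_set may_table tinc_table (extendable n coreless non_table hom_table bit kc (c_le c) col rp) (size A) [::] A &
      all (fun k => ~~ live may_table non_table tinc_table A k || extendableT may_table hom_table bit tinc_table A col rp k) TL].

Definition checks :=
  [&& all wf pats, pairs_ok_in true (c_adj c), pairs_ok_in false (c_non c), hom_ok_in, chain_ok_in,
      triples_ok_in true, triples_ok_in false, types_ok_in,
      all (fun kl => (kl.1 < n) && (kl.2 < n)) (c_le c),
      all colouring_ok (c_sols c) & unreal [seq s.1.1 | s <- c_sols c] [::] Hb].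
End Check.
(** The base matrix and the classes of the base vertices are passed as arguments so that they are
    computed once. *)
Definition check (pats : seq bmatrix) (c : cert) : bool :=
  let Hb := full (c_base c) in
  checks pats c Hb [seq index r (c_types c) | r <- Hb].

(** * From an accepted certificate to niceness *)

Section Soundness.
Variables (G : sgraph) (pats : seq bmatrix) (c : cert) (b : seq G) (d : G).
Implicit Types (x y z : G) (s : seq G).
Hypothesis free : forall p, p \in pats -> ~ contains G p.
Hypothesis wfs : all wf pats.
Hypothesis base_b : tri b = c_base c.
Let Hb := full (c_base c).
Let kcs := [seq index r (c_types c) | r <- Hb].
Let n := size (c_base c).
Let N := size (c_types c).
Let cl x := index (trace b x) (c_types c).
Let typ i := nth [::] (c_types c) i.
Let may := may_table c.
Let non := non_table c.
Let hom := hom_table c.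
Let chain := chain_table c.
Let tinc := tinc_table c.

Lemma refuted_rows k f s : refuted pats k f (rows s) = false.
Proof.
case: k => //= k; case: ifP => // kp; apply/negP.
move/(found_contains (allP wfs _ (mem_nth _ kp))).
by apply/free/mem_nth.
Qed.

Lemma size_b : size b = n.
Proof. by rewrite /n -base_b; elim: (b) => //= x s ->. Qed.

Lemma rows_b : rows b = Hb.
Proof. by rewrite /Hb -base_b full_tri. Qed.

Hypothesis types_ok : types_ok_in pats c.

Lemma has_found_rows f (ps : seq bmatrix) s :
  {subset ps <= pats} -> has_found f ps (rows s) = false.
Proof.
elim: ps => //= p ps IH sub; have pp : p \in pats by apply: sub; rewrite mem_head.
case: ifP => [/(found_contains (allP wfs _ pp))/(free pp) //|_].
by apply: IH => q qp; apply: sub; rewrite inE qp orbT.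
Qed.

Lemma tails_cat (pre s : seq G) : exists ss, tails (tri (pre ++ s)) = tails (tri s) ++ ss.
Proof.
elim: pre => [|y pre [ss e]] /=; first by exists [::]; rewrite cats0.
by eexists; rewrite e -cats1 -catA.
Qed.

(** [s] is the end of the base already read and [pre] the rest. Induction removes the last vertex of
    [pre], the order in which [covers] reads bits. *)
Lemma covers_trace (pre s : seq G) x ss ts :
  tails (tri (pre ++ s)) = tails (tri s) ++ ss -> covers pats ss (trace s x) ts ->
  exists2 t, t \in ts & take (size pre) t = rev (trace pre x).
Proof.
elim/last_ind: pre s ss ts => [|pre y IH] s ss ts.
  rewrite cat0s -{1}[tails (tri s)]cats0 => /eqP; rewrite eqseq_cat // eqxx /= => /eqP <- /=.
  by case: ts => // t ts _; exists t; rewrite ?mem_head // take0.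
rewrite cat_rcons; have [ss' e] := tails_cat pre (y :: s); rewrite e /=.
rewrite -cats1 -catA => /eqP; rewrite eqseq_cat // eqxx /= => /eqP <- /=.
move=> h; have {h} : covers_step pats (covers pats ss') (trace s y :: tri s)
    (trace s x) ts (radj x y).
  by move: h; case: (radj x y); case: (covers_step _ _ _ _ _ true).
rewrite /covers_step; set ts' := [seq behead t | t <- _ & _].
have -> : extend (radj x y :: trace s x) (full (trace s y :: tri s)) =
    rows [:: x, y & s] by rewrite rows_cons -(full_tri (y :: s)).
rewrite has_found_rows // => h.
have {h} : covers pats ss' (trace (y :: s) x) ts' by move: h; case: (ts').
move=> /(IH _ _ _ e)[t']; move=> /mapP[t]; rewrite mem_filter => /andP[ht tts] ->.
move=> tk; exists t => //; rewrite size_rcons /trace map_rcons rev_rcons -tk.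
by case: t ht {tts tk} => [|a t] /=; [case: (radj x y)|move=> /eqP ->].
Qed.

Lemma cl_lt x : cl x < N.
Proof.
have /andP[/allP sz cov] := types_ok.
have e : tails (tri (b ++ [::])) = tails (tri ([::] : seq G)) ++ tails (c_base c).
  by rewrite cats0 base_b.
have [t /mapP[u uc ->]] := covers_trace (x := x) e cov.
rewrite take_oversize ?size_rev ?(eqP (sz _ uc)) ?size_b // => /(can_inj revK) ux.
by rewrite /cl -ux index_mem.
Qed.

Lemma typ_cl x : typ (cl x) = trace b x.
Proof. by rewrite /typ nth_index // -index_mem cl_lt. Qed.

Lemma rows1 x : rows (x :: b) = host1 c Hb (cl x).
Proof. by rewrite rows_cons rows_b /host1 -/(typ _) typ_cl. Qed.

Lemma rows2 x y : rows [:: x, y & b] = host2 c Hb (radj x y) (cl x) (cl y).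
Proof. by rewrite rows_cons rows1 /host2 -/(typ _) typ_cl. Qed.

Lemma rows3 x y z : rows [:: x, y, z & b] =
  host3 c Hb (radj x y) (radj x z) (radj y z) (cl x) (cl y) (cl z).
Proof. by rewrite rows_cons rows2 /host3 -/(typ _) typ_cl. Qed.

Lemma rows4 x y z w : rows [:: x, y, z, w & b] =
  host4 c Hb (radj x y) (radj x z) (radj x w) (radj y z) (radj y w) (radj z w)
    (cl x) (cl y) (cl z) (cl w).
Proof. by rewrite rows_cons rows3 /host4 -/(typ _) typ_cl. Qed.

Lemma get_sym M i j : get M i j = get M j i.
Proof. by rewrite /get; case: ltngtP => // ->. Qed.

Lemma pairs_ok e M x y : pairs_ok_in pats c Hb e M -> radj x y = e ->
  get M (cl x) (cl y) == 0.
Proof.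
move=> ok; wlog le : x y / cl y <= cl x.
  move=> wl; case: (leqP (cl y) (cl x)) => [le|/ltnW le] xy; first exact: wl.
  by rewrite get_sym; apply: wl; rewrite // radj_sym.
move=> xy; move: ok => /allP/(_ (cl x)); rewrite mem_iota cl_lt.
move=> /(_ isT)/allP/(_ (cl y)); rewrite mem_iota /= add0n ltnS => /(_ le).
by case: ifP => // _; rewrite -xy -rows2 refuted_rows.
Qed.

Hypothesis adj_ok : pairs_ok_in pats c Hb true (c_adj c).
Hypothesis non_okp : pairs_ok_in pats c Hb false (c_non c).

Lemma may_cl x y : radj x y -> may (cl x) (cl y).
Proof. exact: pairs_ok. Qed.

Lemma non_cl x y : ~~ radj x y -> non (cl x) (cl y).
Proof. by move=> /negbTE; apply: pairs_ok. Qed.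

Lemma hom_cl : hom_ok_in pats c Hb -> forall w x y, hom (cl x) (cl y) ->
  cl w = cl x -> radj w x -> radj x y -> radj w y.
Proof.
move=> ok w x y h wx rwx rxy; apply/negPn/negP => nwy; move: h.
rewrite /hom /hom_table -wx -/non non_cl // => /hasP[t tc /eqP e].
have := allP ok _ tc; rewrite e /= {2}wx => h.
by move: h; have := rows3 w x y; rewrite rwx (negPf nwy) rxy => <-; rewrite refuted_rows.
Qed.

Lemma chain_cl : chain_ok_in pats c Hb -> forall x x' y z, chain (cl x) (cl y) (cl z) ->
  cl x' = cl x -> radj x x' -> radj x y -> radj x' z -> radj x' y || radj x z.
Proof.
move=> ok x x' y z h xx' rxx' rxy rxz.
wlog le : x x' y z h xx' rxx' rxy rxz / cl y <= cl z.
  move=> wl; case: (leqP (cl y) (cl z)) => [le|/ltnW le]; first exact: wl.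
  rewrite orbC; apply: wl => //; last by rewrite radj_sym.
  by rewrite xx' /chain /chain_table minnC maxnC.
apply/negPn; rewrite negb_or; apply/negP => /andP[n1 n2].
move: h; rewrite /chain /chain_table => /hasP[t tc /eqP].
rewrite (minn_idPl le) (maxn_idPr le).
have := allP ok _ tc; case: t tc => -[[i u] v] [k1 k0] _ /= h [ei eu ev]; subst i u v.
have := rows4 x' x y z; rewrite radj_sym rxx' (negPf n1) rxz rxy (negPf n2) xx'.
move: h => /andP[h1 h0]; case ryz: (radj y z) => e.
- by move: h1; rewrite -/may may_cl // -e refuted_rows.
- by move: h0; rewrite -/non non_cl ?ryz // -e refuted_rows.
Qed.

Lemma tinc_cl : triples_ok_in pats c Hb true -> triples_ok_in pats c Hb false ->
  forall q x y, radj q x -> radj q y -> ~~ tinc (radj x y) (cl q) (cl x) (cl y).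
Proof.
move=> ok1 ok0 q x y qx qy.
wlog le : x y qx qy / cl x <= cl y.
  move=> wl; case: (leqP (cl x) (cl y)) => [le|/ltnW le]; first exact: wl.
  have := wl _ _ qy qx le; rewrite radj_sym /tinc /tinc_table minnC maxnC.
  by rewrite /may_table /non_table ![get _ (cl y) _]get_sym.
apply/negP; rewrite /tinc /tinc_table; case: ifP => [_|].
  rewrite (minn_idPl le) (maxn_idPr le) => /hasP[t tc /eqP e].
  have ok : triples_ok_in pats c Hb (radj x y) by case: (radj x y).
  have /allP/(_ (cl q)) := ok; rewrite mem_iota cl_lt => /(_ isT)/allP/(_ _ tc).
  by rewrite e /=; have := rows3 q x y; rewrite qx qy => <-; rewrite refuted_rows.
by case xy: (radj x y); [rewrite -/may (may_cl xy) | rewrite -/non non_cl ?xy].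
Qed.

Lemma bit_cl k x : k < n -> radj x (nth d b k) = bit c k (cl x).
Proof. by move=> kn; rewrite /bit -/(typ _) typ_cl (nth_map d) // size_b. Qed.

Lemma kc_cl k : k < n -> cl (nth d b k) = kc kcs k.
Proof.
move=> kn; rewrite /kc /kcs (nth_map [::]) -rows_b ?size_map ?size_b //.
by rewrite (nth_map d) // size_b.
Qed.

Definition zero x := ~~ has id (drop (n - c_core c) (trace b x)).

Lemma zero_cl x : coreless c (cl x) = zero x.
Proof. by rewrite /coreless -/(typ _) typ_cl. Qed.

Lemma vectorsP x (xs : seq G) : trace xs x \in vectors c (cl x) [seq cl y | y <- xs].
Proof.
elim: xs => //= y xs IH; rewrite mem_cat; case xy: (radj x y).
  by rewrite -/may may_cl // map_f.
by rewrite -/non non_cl ?xy // map_f ?orbT.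
Qed.

Lemma unrealP (rems : seq (seq nat)) (xs : seq G) :
  {in rems, forall r, exists x, cl x \in r} ->
  unreal pats c rems [seq cl y | y <- xs] (rows (xs ++ b)) = false.
Proof.
elim: rems xs => [|r rems IH] xs ex /=.
  by elim: (c_leaf c) => //= k ks ->; rewrite refuted_rows.
have [x xr] := ex r (mem_head _ _).
have ex' : {in rems, forall r, exists x, cl x \in r}.
  by move=> r' h; apply: ex; rewrite inE h orbT.
apply/negP => /allP/(_ _ xr); case: ifP => _; first by rewrite IH.
move=> /allP/(_ _ (vectorsP x xs)).
have -> : extend (trace xs x ++ nth [::] (c_types c) (cl x)) (rows (xs ++ b)) =
    rows ((x :: xs) ++ b).
  by rewrite rows_cons -/(typ _) typ_cl /trace map_cat.
by rewrite (IH (x :: xs)).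
Qed.

Hypothesis T_trans : forall q r s : G, zero q -> zero r -> zero s ->
  radj q r -> radj r s -> radj q s.
Hypothesis T_hom : forall x q r : G, ~~ zero x -> zero q -> zero r ->
  radj q r -> radj x q -> radj x r.
Hypothesis T_nbr : forall q : G, zero q -> exists x y : G,
  [/\ ~~ zero x /\ ~~ zero y, radj q x, radj q y & ~~ radj x y].
Hypothesis le_b : forall k l, (k, l) \in c_le c ->
  #|[set x | trace b x == trace b (nth d b k)]| <=
  #|[set x | trace b x == trace b (nth d b l)]|.

Lemma nice_of_checks : checks pats c Hb kcs -> nice G.
Proof.
rewrite /checks => /and5P[_ _ _ hh /and5P[hc t1 t0 _ /and3P[les sols un]]].
have {}les := allP les; pose s0 : seq nat * seq nat * seq rep := ([::], [::], [::]).
(* Some solution applies: otherwise every list of forbidden classes is met, and vertices chosen from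
   the lists form a configuration that [unreal] has refuted. *)
have [i ic ns] : exists2 i, i < size (c_sols c) &
    forall x, cl x \notin (nth s0 (c_sols c) i).1.1.
  case: (boolP (has (fun s : seq nat * seq nat * seq rep => [forall x, cl x \notin s.1.1]) (c_sols c))).
    by move=> /(has_nthP s0)[i ic /forallP ns]; exists i.
  rewrite -all_predC => /(all_nthP s0) h.
  suff ex : {in [seq u.1.1 | u <- c_sols c], forall r : seq nat, exists x, cl x \in r}.
    by have := @unrealP _ [::] ex; rewrite /= rows_b un.
  move=> r /(nthP [::])[i]; rewrite size_map => ic <-.
  have := h _ ic; rewrite (nth_map s0) //= negb_forall => /existsP[x].
  by rewrite negbK; exists x.
have /and4P[h1 h2 h3 h4] := all_nthP s0 sols _ ic.
apply: (@nice_of_colouring G (nth d b) n cl (coreless c) may non hom chain (bit c) (kc kcs)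
  tinc may_cl non_cl (hom_cl hh) (chain_cl hc) _ _ (tinc_cl t1 t0)
  _ _ _ (c_le c) _ _ _ _ _ _ _ _ h1 h2 _ h3 h4) => //.
- by move=> k x; apply: bit_cl.
- by move=> k; apply: kc_cl.
- by move=> q r s'; rewrite !zero_cl; apply: T_trans.
- by move=> x q r; rewrite !zero_cl; apply: T_hom.
- by move=> q; rewrite zero_cl => /T_nbr[x [y]]; rewrite -!zero_cl; exists x, y.
- move=> k l kl; have /andP[kn ln] := les _ kl; split=> //.
  have e j : j < n -> class_set cl (kc kcs j) = [set x | trace b x == trace b (nth d b j)].
    move=> jn; apply/setP => x; rewrite !inE -kc_cl //.
    apply/eqP/eqP => [h|]; last by rewrite /cl => ->.
    by rewrite -!typ_cl h.
  by rewrite !e // le_b.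
- by move=> x xT; rewrite mem_filter xT ns mem_iota cl_lt.
- by move=> j; rewrite mem_filter => /andP[/andP[]].
- by move=> x xT; rewrite mem_filter xT mem_iota cl_lt.
- by rewrite filter_uniq ?iota_uniq.
Qed.
End Soundness.

(** * Vertices without neighbours in the core *)

Section Separation.
Variable G : sgraph.
Hypotheses (G_connected : connected G) (G_atom : atom G).

Lemma connect_adj_sym (H : sgraph) : connect_sym (@adj H).
Proof. by apply: sym_connect_sym; apply: adj_sym. Qed.

Lemma components_le1 : components G <= 1.
Proof.
rewrite /components /n_comp_mem leqNgt; apply/negP => /card_gt1P[x [y []]].
rewrite !inE => /andP[rx _] /andP[ry _] /eqP; apply.
rewrite -(eqP rx) -(eqP ry).
by apply/(rootP (@connect_adj_sym G)).
Qed.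

Lemma components_gt1 (H : sgraph) (x y : H) :
  ~~ connect (@adj H) x y -> 1 < components H.
Proof.
move=> nc; apply/card_gt1P; exists (root (@adj H) x), (root (@adj H) y).
rewrite !inE !roots_root //; try exact: connect_adj_sym.
by split=> //; rewrite root_connect //; exact: connect_adj_sym.
Qed.

(* The neighbourhood of a component of [Z] separates it from [s], so it is not a
   clique. *)
Lemma atom_separator (Z : pred G) (q s : G) :
  Z q -> ~~ Z s -> (forall y, Z y -> ~~ adj s y) ->
  exists x y, [/\ ~~ Z x, ~~ Z y, ~~ radj x y &
    exists q' q'', [/\ radj x q', radj y q'',
      connect [rel u v | [&& Z u, Z v & adj u v]] q q' &
      connect [rel u v | [&& Z u, Z v & adj u v]] q q'']].
Proof.
move=> qZ sZ sn; set e := [rel u v | _].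
have es : connect_sym e.
  by apply: sym_connect_sym => u v; rewrite /= adj_sym andbCA.
have QZ y : connect e q y -> Z y.
  move=> c; have cl : closed e Z.
    by apply: intro_closed => // u v /and3P[].
  by have := closed_connect cl c; rewrite !unfold_in qZ => /esym.
pose N := [set x | ~~ Z x && [exists y, connect e q y && radj x y]].
have NP x : x \in N -> ~~ Z x /\ exists2 y, connect e q y & radj x y.
  by rewrite inE => /andP[-> /existsP[y /andP[]]]; split=> //; exists y.
have [cN|] := boolP (cliqueb N); last first.
  rewrite negb_forall => /existsP[x]; rewrite negb_imply => /andP[xN].
  rewrite negb_forall => /existsP[y]; rewrite !negb_imply => /and3P[yN xy nxy].
  have [xZ [q1 c1 a1]] := NP _ xN; have [yZ [q2 c2 a2]] := NP _ yN.
  exists x, y; split=> //; first by rewrite /radj negb_or xy.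
  by exists q1, q2.
case: (G_atom (Q := N)); split; first exact/cliqueP.
apply: leq_ltn_trans components_le1 _.
have qN : q \in ~: N by rewrite !inE qZ.
have sN : s \in ~: N.
  rewrite !inE sZ /=; apply/existsP => -[y /andP[/QZ yZ]].
  by rewrite /radj (negPf (sn _ yZ)) orbF => /eqP h; rewrite h yZ in sZ.
apply: (@components_gt1 (del N) (exist _ q qN) (exist _ s sN)).
apply/negP => c; have cl : closed (@adj (del N)) [pred v | connect e q (val v)].
  apply: intro_closed; first exact: connect_adj_sym.
  move=> u v uv; rewrite !inE => cu; have vN := valP v.
  have vZ : Z (val v).
    move: vN; rewrite !inE negb_and negbK => /orP[//|/existsP[]]; exists (val u).
    by rewrite cu /radj adj_sym [adj _ _]uv orbT.
  apply: (connect_trans cu); apply: connect1 => /=.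
  by rewrite (QZ _ cu) vZ; exact: uv.
by have := closed_connect cl c; rewrite !inE connect0 => /esym/QZ; apply/negP.
Qed.
End Separation.

Fixpoint all_masks n : seq (seq bool) :=
  if n is n'.+1 then [seq true :: m | m <- all_masks n'] ++ [seq false :: m | m <- all_masks n']
  else [:: [::]].

Lemma mem_all_masks m : m \in all_masks (size m).
Proof. by elim: m => //= -[] m IH; rewrite mem_cat map_f ?orbT. Qed.

(* A hub is a vertex complete to the core.  Unlike for other vertices, that a hub
   does not split an edge qr outside the neighbourhood of the core cannot be seen
   on q, r and the hub alone: one needs two nonadjacent vertices attached to the
   component of q, given by [atom_separator]. *)
Section CoreCheck.
Variables (pats : seq bmatrix) (p : bmatrix).
Let H := full p.
Let z := nseq (size p) false.
Let h := nseq (size p) true.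
Let refute := has_found 0 pats.
Let edge := extend (true :: z) (extend z H).

Definition core_masks :=
  [seq m <- all_masks (size p) | has id m && ~~ has_found 1 pats (extend m H)].
Definition refute_split m := refute (extend [:: true, false & m] edge).
Definition refute_hubs := refute (extend (false :: h) (extend h H)).
Definition refute_mixed m :=
  refute (extend [:: false, true, true & m] (extend [:: true, false & h] edge)).
Definition refute_far m m' a b :=
  refute (extend [:: false, a, true, true & m] (extend [:: b, true, true & m']
    (extend [:: true, false & h] edge))).

Definition check_core :=
  let al := core_masks in
  let nh := [seq m <- al | ~~ all id m] in
  all refute_split nh &&
  if has (all id) al then
    [&& refute_hubs, all refute_mixed nh &
        all (fun m => all (fun m' => [&& refute_far m m' true true,
          refute_far m m' true false, refute_far m m' false true
          & refute_far m m' false false]) al) nh]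
  else true.
End CoreCheck.

Section Core.
Variables (G : sgraph) (pats : seq bmatrix) (p : bmatrix) (s : seq G) (s0 : G).
Implicit Types (x y z : G).
Hypothesis free : forall p, p \in pats -> ~ contains G p.
Hypothesis wfs : all wf pats.
Hypothesis tri_s : tri s = p.
Hypothesis s0s : s0 \in s.
Hypothesis ok : check_core pats p.
Hypotheses (G_connected : connected G) (G_atom : atom G).
Let Z x := ~~ has id (trace s x).
Let hub x := all id (trace s x).
Let e := [rel u v | [&& Z u, Z v & adj u v]].

Let size_s : size p = size s.
Proof. by rewrite -tri_s; elim: (s) => //= x t ->. Qed.

Let rows_s : full p = rows s.
Proof. by rewrite -tri_s full_tri. Qed.

Let zmask q : Z q -> nseq (size p) false = trace s q.
Proof.
rewrite size_s /Z; elim: (s) => //= x t IH; rewrite negb_or => /andP[/negPf -> h].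
by rewrite IH.
Qed.

Let hmask q : hub q -> nseq (size p) true = trace s q.
Proof. by rewrite size_s /hub; elim: (s) => //= x t IH /andP[-> h]; rewrite IH. Qed.

Let fr f (t : seq G) : has_found f pats (rows t) = false.
Proof. exact: (has_found_rows free wfs). Qed.

Lemma mem_core_masks x : ~~ Z x -> trace s x \in core_masks pats p.
Proof.
rewrite negbK => h; have k : has_found 1 pats (extend (trace s x) (full p)) = false.
  by rewrite rows_s -(rows_cons x s) fr.
rewrite /core_masks mem_filter h k /=.
by rewrite size_s -(size_map (radj x) s) mem_all_masks.
Qed.

Let Zs : ~~ Z s0.
Proof. by rewrite negbK; apply/hasP; exists true => //; rewrite -(radj_refl s0) map_f. Qed.

Let Zn q : Z q -> ~~ radj s0 q.
Proof.
apply: contra => h; apply/hasP; exists true => //.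
by rewrite -h radj_sym map_f.
Qed.

Let trace_cons x y (t : seq G) : trace (y :: t) x = radj x y :: trace t x.
Proof. by []. Qed.

Let edge_rows q r : Z q -> Z r -> radj q r -> rows [:: q, r & s] =
  extend (true :: nseq (size p) false) (extend (nseq (size p) false) (full p)).
Proof.
by move=> qZ rZ qr; rewrite !rows_cons {1}(zmask qZ) (zmask rZ) rows_s /trace /= qr.
Qed.

Let nonhub_hom x q r : ~~ Z x -> ~~ hub x -> Z q -> Z r -> radj q r ->
  radj x q -> radj x r.
Proof.
move=> xZ xh qZ rZ qr xq; apply/negPn/negP => xr.
have /andP[/allP/(_ (trace s x))] := ok.
rewrite mem_filter xh mem_core_masks // => /(_ isT) + _.
have := fr 0 [:: x, q, r & s].
by rewrite rows_cons edge_rows // /trace /= xq (negbTE xr) /refute_split => ->.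
Qed.

Let comp_hom (P : pred G) q u v : (forall u v, e u v -> connect e q u -> P u -> P v) ->
  connect e q u -> connect e q v -> P u -> P v.
Proof.
move=> st qu qv Pu.
have es : connect_sym e.
  by apply: sym_connect_sym => a b; rewrite /= adj_sym andbCA.
have cl : closed e [pred a | connect e q a && P a].
  apply: intro_closed => // a b ab; rewrite !inE => /andP[qa Pa].
  by rewrite (st a b) // (connect_trans qa) ?connect1.
have uv : connect e u v by rewrite (connect_trans _ qv) // es.
by have := closed_connect cl uv; rewrite !inE qu qv Pu.
Qed.

Let separator q : Z q -> exists x y, [/\ ~~ Z x, ~~ Z y, ~~ radj x y &
    exists q' q'', [/\ radj x q', radj y q'', connect e q q' & connect e q q'']].
Proof.
move=> qZ; apply: (atom_separator G_connected G_atom (s := s0)) => // y /Zn.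
by rewrite negb_or => /andP[].
Qed.

Let adj_e q r : Z q -> Z r -> radj q r -> connect e q r.
Proof. by move=> qZ rZ /orP[/eqP->|h]; [exact: connect0|apply: connect1; rewrite /= qZ rZ]. Qed.

Let nonhub_comp x q u v : ~~ Z x -> ~~ hub x -> connect e q u -> connect e q v ->
  radj x u -> radj x v.
Proof.
move=> xZ xh; apply: comp_hom => a b /and3P[aZ bZ ab] _; apply: nonhub_hom => //.
by rewrite /radj ab orbT.
Qed.

Lemma core_hom x q r : ~~ Z x -> Z q -> Z r -> radj q r -> radj x q -> radj x r.
Proof.
move=> xZ qZ rZ qr xq; apply/negPn/negP => xr.
have [xh|xh] := boolP (hub x); last by rewrite (nonhub_hom xZ xh qZ rZ qr xq) in xr.
have /andP[_] := ok; rewrite (_ : has _ _); last first.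
  by apply/hasP; exists (trace s x) => //; apply: mem_core_masks.
case/and3P => rh /allP rm /allP rf.
have far y w : ~~ Z y -> ~~ hub y -> ~~ Z w -> ~~ radj y w -> radj y q -> radj y r ->
    radj w q -> radj w r -> False.
  move=> yZ yh wZ yw yq yr wq wr.
  have := rf (trace s y); rewrite mem_filter yh mem_core_masks // => /(_ isT)/allP/(_ _ (mem_core_masks wZ)).
  have : refute_far pats p (trace s y) (trace s w) (radj y x) (radj w x) = false.
    have := fr 0 [:: y, w, x, q, r & s].
    rewrite 3!rows_cons edge_rows // !trace_cons -(hmask xh).
    by rewrite xq (negbTE xr) wq wr yq yr (negbTE yw).
  by case: (radj y x); case: (radj w x) => -> /and4P[].
have mixed y w u v : ~~ Z y -> ~~ hub y -> hub w -> ~~ radj y w -> e u v ->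
    radj y u -> radj y v -> radj w u -> ~~ radj w v -> False.
  move=> yZ yh wh yw /and3P[uZ vZ uv] yu yv wu wv.
  have uv' : radj u v by rewrite /radj uv orbT.
  have := rm (trace s y); rewrite mem_filter yh mem_core_masks // => /(_ isT).
  have := fr 0 [:: y, w, u, v & s].
  rewrite 2!rows_cons edge_rows // !trace_cons -(hmask wh).
  by rewrite yu yv (negbTE yw) wu (negbTE wv) /refute_mixed => ->.
(* The nonhub [y] is complete to the component of [q]. If [w] is too, then [y], [w], [x], [q], [r]
   give the [far] configuration; if not, [w] is a hub that splits some edge of the component, the
   [mixed] one. *)
have main y w q' q'' : ~~ Z y -> ~~ hub y -> ~~ Z w -> ~~ radj y w -> radj y q' -> radj w q'' ->
    connect e q q' -> connect e q q'' -> False.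
  move=> yZ yh wZ yw yq' wq'' c' c''.
  have yc v : connect e q v -> radj y v by move=> c; apply: (nonhub_comp (u := q') yZ yh c').
  have fin : ~ (forall v, connect e q v -> radj w v).
    have cr := adj_e qZ rZ qr; have cq := connect0 e q.
    by move=> wc; apply: (far y w yZ yh wZ yw); (exact: yc || exact: wc).
  have [wh|wh] := boolP (hub w); last first.
    by apply: fin => v c; apply: (nonhub_comp (u := q'') wZ wh c'').
  have [/existsP[u /existsP[v /and4P[uv cu wu wv]]]|no] :=
      boolP [exists u, [exists v, [&& e u v, connect e q u, radj w u & ~~ radj w v]]].
    apply: (mixed y w u v) => //; first exact: yc.
    by apply: yc; apply: connect_trans cu _; apply: connect1.
  apply: fin => v c; apply: (comp_hom (P := radj w) (q := q) (u := q'')) => // a b ab ca wa.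
  apply/negPn/negP => wb; case/negP: no; apply/existsP; exists a; apply/existsP; exists b.
  by rewrite ab ca wa wb.
(* Nonadjacent hubs are refuted, so one of the two nonadjacent attachments is a nonhub. *)
have [y [w [yZ wZ yw [q' [q'' [yq wq c' c'']]]]]] := separator qZ.
have [yh|yh] := boolP (hub y); last exact: (main y w q' q'').
have [wh|wh] := boolP (hub w).
  have := fr 0 [:: y, w & s]; rewrite 2!rows_cons !trace_cons -(hmask wh) -(hmask yh) -rows_s (negbTE yw).
  by move: rh; rewrite /refute_hubs => ->.
by apply: (main w y q'' q'); rewrite // radj_sym.
Qed.

Lemma core_nbr q : Z q -> exists x y : G,
  [/\ ~~ Z x /\ ~~ Z y, radj q x, radj q y & ~~ radj x y].
Proof.
move=> qZ; have [x [y [xZ yZ xy [q' [q'' [xq yq c' c'']]]]]] := separator qZ.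
have st w u : ~~ Z w -> connect e q u -> radj w u -> radj q w.
  move=> wZ c wu; rewrite radj_sym; apply: (comp_hom (P := radj w) (q := q) (u := u)) => //.
  by move=> a b /and3P[aZ bZ ab] _; apply: core_hom; rewrite // /radj ab orbT.
by exists x, y; split; rewrite // ?(st x q') ?(st y q'').
Qed.

End Core.

(** * The patterns and their certificates *)

Delimit Scope dec_uint_scope with dg.
Import Number.
Fixpoint dec_digits (u : Decimal.uint) : seq nat :=
  match u with
  | Decimal.Nil => [::]
  | Decimal.D0 u => 0 :: dec_digits u | Decimal.D1 u => 1 :: dec_digits u
  | Decimal.D2 u => 2 :: dec_digits u | Decimal.D3 u => 3 :: dec_digits u
  | Decimal.D4 u => 4 :: dec_digits u | Decimal.D5 u => 5 :: dec_digits u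
  | Decimal.D6 u => 6 :: dec_digits u | Decimal.D7 u => 7 :: dec_digits u
  | Decimal.D8 u => 8 :: dec_digits u | Decimal.D9 u => 9 :: dec_digits u
  end.
Fixpoint hex_digits (u : Hexadecimal.uint) : seq nat :=
  match u with
  | Hexadecimal.Nil => [::]
  | Hexadecimal.D0 u => 0 :: hex_digits u | Hexadecimal.D1 u => 1 :: hex_digits u
  | Hexadecimal.D2 u => 2 :: hex_digits u | Hexadecimal.D3 u => 3 :: hex_digits u
  | Hexadecimal.D4 u => 4 :: hex_digits u | Hexadecimal.D5 u => 5 :: hex_digits u
  | Hexadecimal.D6 u => 6 :: hex_digits u | Hexadecimal.D7 u => 7 :: hex_digits u
  | Hexadecimal.D8 u => 8 :: hex_digits u | Hexadecimal.D9 u => 9 :: hex_digits u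
  | Hexadecimal.Da u => 10 :: hex_digits u | Hexadecimal.Db u => 11 :: hex_digits u
  | Hexadecimal.Dc u => 12 :: hex_digits u | Hexadecimal.Dd u => 13 :: hex_digits u
  | Hexadecimal.De u => 14 :: hex_digits u | Hexadecimal.Df u => 15 :: hex_digits u
  end.
(** A table row is written as one numeral: [Number.uint] keeps the digits as written, including
    leading zeros, and hexadecimal reaches codes above 9. *)
Definition digits (u : Number.uint) : seq nat :=
  match u with UIntDecimal d => dec_digits d | UIntHexadecimal h => hex_digits h end.
Arguments digits u%_dec_uint_scope.
Definition codes (us : seq Number.uint) := map digits us.
Definition masks (us : seq Number.uint) : bmatrix := [seq map (eqn 1) (digits u) | u <- us].
(* With respect to the 5-cycle 1, ..., 5, which comes last in each pattern: vertices
   of kind A_i have the neighbours i-1, i+1, of kind D_i the neighbours i, i+2, i-2,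
   of kind F_i all but i, and z is adjacent to all five.  H12 is the complement of the
   icosahedron. *)
Definition pat_P5 : bmatrix := masks [:: 1000; 100; 10; 1]%dg ++ [:: [::]].
Definition pat_W4 : bmatrix := masks [:: 1011; 101; 11; 1]%dg ++ [:: [::]].
Definition pat_C5 : bmatrix := masks [:: 1001; 100; 10; 1]%dg ++ [:: [::]].
Definition pat_C7c : bmatrix := masks [:: 011110; 01111; 0111; 011; 01; 0]%dg ++ [:: [::]].
Definition pat_H12 : bmatrix := masks [:: 00000111111; 1001101101; 100110110; 10101011; 1110101; 111010; 00000]%dg ++ pat_C5.
(** The complement of the icosahedron less two opposite vertices; [pat_zICO] keeps one of these. *)
Definition pat_ICO : bmatrix := masks [:: 100101101; 10010110; 1001011; 110101; 11010]%dg ++ pat_C5.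
Definition pat_zICO : bmatrix := masks [:: 0000011111; 100101101; 10010110; 1001011; 110101; 11010]%dg ++ pat_C5.
Definition pat_HQ4 : bmatrix := masks [:: 000011111; 10001101; 1010110; 101011; 10101]%dg ++ pat_C5.
Definition pat_zDD : bmatrix := masks [:: 0011111; 101011; 10101]%dg ++ pat_C5.
Definition pat_W5 : bmatrix := masks [:: 11111]%dg ++ pat_C5.
Definition pat_Q4X : bmatrix := masks [:: 100001101101; 10010010110; 1100001011; 001110101; 11110100; 1101001; 010010; 01010]%dg ++ pat_C5.
Definition pat_Q4 : bmatrix := masks [:: 10001101; 1010110; 101011; 10101]%dg ++ pat_C5.
Definition pat_Q4e : bmatrix := masks [:: 10101101; 1010110; 101011; 10101]%dg ++ pat_C5.
Definition pat_D123 : bmatrix := masks [:: 1010110; 101011; 10101]%dg ++ pat_C5.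
Definition pat_G7 : bmatrix := masks [:: 010110; 10111]%dg ++ pat_C5.
Definition pat_G6 : bmatrix := masks [:: 010110; 01111]%dg ++ pat_C5.
Definition pat_G5 : bmatrix := masks [:: 110110; 01111]%dg ++ pat_C5.
Definition pat_G2 : bmatrix := masks [:: 101001; 01011]%dg ++ pat_C5.
Definition pat_G8 : bmatrix := masks [:: 110110; 10101]%dg ++ pat_C5.
Definition pat_G1 : bmatrix := masks [:: 110110; 01011]%dg ++ pat_C5.
Definition pat_T13 : bmatrix := masks [:: 1100000; 010110; 10101]%dg ++ pat_C5.
Definition pat_D1 : bmatrix := masks [:: 10110]%dg ++ pat_C5.
Definition pat_A1 : bmatrix := masks [:: 01001]%dg ++ pat_C5.
Definition pat_G8b : bmatrix := masks [:: 10110110; 1010101; 001010; 01001]%dg ++ pat_C5.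
Definition pat_G8a : bmatrix := masks [:: 10110110; 1010101; 101010; 01001]%dg ++ pat_C5.

Definition cert_H12 : cert := Cert pat_H12 12
  (masks [:: 100000111111; 110101011100; 010011111010; 101011011001; 011100110110; 000111110101; 110110010011; 111010001110; 011001101101; 001110101011; 101101000111; 111111100000; 000000000000]%dg)
  (codes [:: 0x0; 0x00; 0x100; 0x0000; 0x11100; 0x110010; 0x0110100; 0x00110010; 0x100101000; 0x1011000110; 0x01010100100; 0x010100110010; 0x1111111111110]%dg)
  (codes [:: 0x2; 0x12; 0x012; 0x1112; 0x00012; 0x001102; 0x1001012; 0x11001102; 0x011010112; 0x0100111002; 0x10101011012; 0x101011001102; 0x0000000000000]%dg)
  [::]
  [::]
  (fun e => if e then [:: [::]; [::]; [::]; [::]; [::]; [::]; [::]; [::]; [::]; [::]; [::]; [::]; [::]] else [:: [::]; [::]; [::]; [::]; [::]; [::]; [::]; [::]; [::]; [::]; [::]; [::]; [::]])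
  [:: (0, 7); (8, 7); (9, 7); (10, 7); (11, 7); (1, 7); (2, 7); (3, 7); (4, 7); (5, 7); (6, 7)]
  [:: ([::], digits 0302331120210, [:: Any; Any; Any; Any; Any; Any; Any; Any; Any; Any; Any; Any; Any])]
  [::].
Lemma check_H12 : check [:: pat_P5; pat_W4] cert_H12.
Proof. by vm_compute. Qed.

Definition cert_zICO : cert := Cert pat_zICO 11
  (masks [:: 10000011111; 01001111010; 01110010110; 00011110101; 01100101101; 00111001011; 11010111100; 10101111001; 11011010011; 11101001110; 10110100111; 00000000000]%dg)
  (codes [:: 0x0; 0x10; 0x110; 0x1010; 0x10010; 0x110010; 0x0011000; 0x00001100; 0x011000100; 0x0100010110; 0x00011011000; 0x111111111110]%dg)
  (codes [:: 0x2; 0x02; 0x002; 0x0102; 0x01102; 0x001102; 0x1100112; 0x11110012; 0x100111012; 0x1011101002; 0x11100100112; 0x000000000000]%dg)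
  [::]
  [::]
  (fun e => if e then [:: [::]; [::]; [::]; [::]; [::]; [::]; [::]; [::]; [::]; [::]; [::]; [::]] else [:: [::]; [::]; [::]; [::]; [::]; [::]; [::]; [::]; [::]; [::]; [::]; [::]])
  [:: (1, 2); (1, 3); (1, 4); (1, 5)]
  [:: ([::], digits 011302321230, [:: Any; Any; Any; Any; Any; Any; Any; Any; Any; Any; Any; Any])]
  [::].
Lemma check_zICO : check [:: pat_P5; pat_W4; pat_H12] cert_zICO.
Proof. by vm_compute. Qed.

Definition cert_HQ4 : cert := Cert pat_HQ4 5
  (masks [:: 0000000101; 0001010100; 0010001001; 0001110101; 0110001101; 1000011111; 1101011100; 1010111001; 0111010110; 0011101011; 1011000111; 1101110011; 1110101110; 0000000000]%dg)
  (codes [:: 0x0; 0x10; 0x110; 0x1110; 0x11110; 0x111110; 0x1101000; 0x10101000; 0x110101100; 0x1010110100; 0x11111011000; 0x010000101000; 0x0010000101020; 0x11111111111110]%dg)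
  (codes [:: 0x0; 0x00; 0x010; 0x0002; 0x00002; 0x000002; 0x0010112; 0x01010112; 0x001010012; 0x0101001012; 0x00000100112; 0x101111010112; 0x1101111010102; 0x00000000000000]%dg)
  [:: (0, 0, 2); (1, 1, 2); (2, 2, 2)]
  [::]
  (fun e => if e then [:: [::]; [::]; [::]; [::]; [::]; [::]; [::]; [::]; [::]; [::]; [::]; [::]; [::]; [::]] else [:: [::]; [::]; [::]; [::]; [::]; [::]; [::]; [::]; [::]; [::]; [::]; [::]; [::]; [::]])
  [::]
  [:: ([::], digits 11211032321320, [:: Any; Any; Any; Any; Any; Any; Any; Any; Any; Any; Any; Any; Any; Any])]
  [::].
Lemma check_HQ4 : check [:: pat_P5; pat_W4; pat_zICO] cert_HQ4.
Proof. by vm_compute. Qed.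

Definition cert_zDD : cert := Cert pat_zDD 5
  (masks [:: 00010010; 00001001; 00000101; 01010100; 00001101; 00101010; 00111010; 01010110; 11011100; 10111001; 01110101; 10101110; 01101011; 11000111; 10011111; 11110011; 00000000; 11000000; 10100000; 11100000]%dg)
  (codes [:: 0x0; 0x10; 0x110; 0x1110; 0x11110; 0x111110; 0x1101310; 0x10113110; 0x101100010; 0x0110110000; 0x11111001100; 0x110001100100; 0x1110111001010; 0x01111000121000; 0x111111110020200; 0x1001011120020000; 0x11111111111111110; 0x111111011111010100; 0x1111111011011101000; 0x11110133110101010000]%dg)
  (codes [:: 0x0; 0x10; 0x100; 0x0100; 0x10000; 0x001100; 0x0010102; 0x01001032; 0x010011102; 0x1001001112; 0x00000110012; 0x001110011012; 0x0001000110102; 0x10000111000112; 0x000000001101012; 0x0110100001101112; 0x00000000000000000; 0x000000000000000000; 0x0000000000000000000; 0x00000000000000000000]%dg)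
  [:: (0, 0, 2); (1, 1, 2); (2, 2, 2); (3, 3, 2); (4, 4, 2); (4, 19, 1); (5, 5, 2); (6, 17, 1); (7, 18, 1); (10, 18, 1); (10, 19, 1); (12, 17, 1); (12, 19, 1)]
  [::]
  (fun e => if e then [:: [::]; [::]; [::]; [::]; [::]; [::]; [::]; [::]; [::]; [::]; [::]; [::]; [::]; [::]; [::]; [::]; [::]; [::]; [::]; [::]] else [:: [::]; [::]; [::]; [::]; [::]; [::]; [::]; [::]; [::]; [::]; [::]; [::]; [::]; [::]; [::]; [::]; [::]; [::]; [::]; [::]])
  [::]
  [:: ([:: 0; 5; 6], digits 03222002132330210000, [:: Any; Any; Any; Any; Any; Any; Any; Any; Any; Any; Any; Any; Any; Any; Self 0; Any; Any; Any; Any; Any]); ([:: 0; 3; 7], digits 03303310202132310000, [:: Any; Any; Any; Any; Any; Any; Any; Any; Any; Any; Any; Any; Any; Any; Self 0; Any; Any; Any; Any; Any]); ([:: 1; 2; 4; 7], digits 30020330212132300000, [:: Any; Any; Any; Any; Any; Any; Any; Any; Any; Any; Any; Any; Any; Any; Self 0; Any; Any; Any; Any; Any]); ([:: 1; 2; 4; 6], digits 10030201321223100000, [:: Any; Any; Any; Any; Any; Any; Any; Any; Any; Any; Any; Any; Any; Any; Self 0; Any; Any; Any; Any; Any])]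
  [:: 1].
Lemma check_zDD : check [:: pat_P5; pat_W4; pat_HQ4] cert_zDD.
Proof. by vm_compute. Qed.

(** Classes 5 to 9 are the kinds D_i nonadjacent to the hub. The kinds D_i and D_(i+1) never both
    occur, so those present lie in some pair D_i, D_(i+2): this gives the five solutions. *)
Definition cert_W5 : cert := Cert pat_W5 5
  (masks [:: 010100; 010010; 001010; 001001; 000101; 011010; 010110; 010101; 001101; 001011; 111100; 111001; 110011; 101110; 100111; 111111; 000000; 100000]%dg)
  (codes [:: 0x0; 0x10; 0x110; 0x1110; 0x11110; 0x111100; 0x1110110; 0x11011310; 0x101113310; 0x0111113310; 0x21001011000; 0x001210001100; 0x1210011000200; 0x01210100010220; 0x100120011022000; 0x2222222222000000; 0x11111111111111100; 0x111110000011111000]%dg)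
  (codes [:: 0x0; 0x00; 0x100; 0x1100; 0x01100; 0x000010; 0x0001000; 0x00100100; 0x010001100; 0x1000001100; 0x00110100112; 0x110001110012; 0x0001100111012; 0x10001011101002; 0x011001100100112; 0x0000000000222222; 0x00000000000000000; 0x000000000000000000]%dg)
  [:: (0, 0, 2); (1, 1, 2); (2, 2, 2); (3, 3, 2); (4, 4, 2); (5, 5, 2); (5, 17, 1); (6, 6, 2); (6, 17, 1); (7, 7, 2); (7, 17, 1); (8, 8, 2); (8, 17, 1); (9, 9, 2); (9, 17, 1)]
  [::]
  (fun e => if e then [:: [::]; [::]; [::]; [::]; [::]; [::]; [::]; [::]; [::]; [::]; [::]; [::]; [::]; [::]; [::]; [::]; [::]; [::]] else [:: [::]; [::]; [::]; [::]; [::]; [::]; [::]; [::]; [::]; [::]; [::]; [::]; [::]; [::]; [::]; [::]; [::]; [::]])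
  [::]
  [:: ([:: 7; 8; 9], digits 312231100032123000, [:: Any; Any; Any; Any; Any; Any; Any; Any; Any; Any; Any; Any; Any; Any; Any; Any; Any; Any]); ([:: 6; 7; 8], digits 233313000321231000, [:: Any; Any; Any; Any; Any; Any; Any; Any; Any; Any; Any; Any; Any; Any; Any; Any; Any; Any]); ([:: 5; 6; 7], digits 213330003323112000, [:: Any; Any; Any; Any; Any; Any; Any; Any; Any; Any; Any; Any; Any; Any; Any; Any; Any; Any]); ([:: 5; 8; 9], digits 331230330032112000, [:: Any; Any; Any; Any; Any; Any; Any; Any; Any; Any; Any; Any; Any; Any; Any; Any; Any; Any]); ([:: 5; 6; 9], digits 321330033021213000, [:: Any; Any; Any; Any; Any; Any; Any; Any; Any; Any; Any; Any; Any; Any; Any; Any; Any; Any])]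
  [::].
Lemma check_W5 : check [:: pat_P5; pat_W4; pat_zDD] cert_W5.
Proof. by vm_compute. Qed.

Definition cert_ICO : cert := Cert pat_ICO 10
  (masks [:: 1010010100; 0010110100; 1010010010; 1001010010; 1001001010; 0101001010; 0101001001; 0100101001; 0100100101; 0010100101; 1010111100; 1001111010; 0101111001; 1110010110; 0011110101; 1011010011; 1101001110; 1100101101; 0111001011; 0110100111; 0000000000]%dg)
  (codes [:: 0x0; 0x10; 0x110; 0x1210; 0x20110; 0x012110; 0x1002110; 0x02102110; 0x210102110; 0x1120102110; 0x11110000110; 0x101111100000; 0x0000111111000; 0x11111000011100; 0x111000011110010; 0x1111110000110100; 0x00111111000110010; 0x010001111100101000; 0x0001111110011000110; 0x11000011111010100100; 0x111111111111111111110]%dg)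
  (codes [:: 0x0; 0x00; 0x000; 0x0100; 0x11000; 0x111000; 0x1111000; 0x11111000; 0x101111000; 0x0011111000; 0x00001111002; 0x010000011112; 0x1111000000112; 0x00000111100012; 0x000111100001102; 0x0000001111001012; 0x11000000111001102; 0x101110000011010112; 0x1110000001100111002; 0x00111100000101011012; 0x000000000000000000000]%dg)
  [:: (0, 0, 2); (1, 1, 2); (2, 2, 2); (3, 3, 2); (4, 4, 2); (5, 5, 2); (6, 6, 2); (7, 7, 2); (8, 8, 2); (9, 9, 2)]
  [::]
  (fun e => if e then [:: [::]; [::]; [::]; [::]; [::]; [::]; [::]; [::]; [::]; [::]; [::]; [::]; [::]; [::]; [::]; [::]; [::]; [::]; [::]; [::]; [::]] else [:: [::]; [::]; [::]; [::]; [::]; [::]; [::]; [::]; [::]; [::]; [::]; [::]; [::]; [::]; [::]; [::]; [::]; [::]; [::]; [::]; [::]])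
  [:: (0, 1); (0, 2); (0, 3); (0, 4)]
  [:: ([::], digits 332221113332123210130, [:: Any; Any; Any; Any; Any; Any; Any; Any; Any; Any; Any; Any; Any; Any; Any; Any; Any; Any; Any; Any; Any])]
  [::].
Lemma check_ICO : check [:: pat_P5; pat_W4; pat_W5] cert_ICO.
Proof. by vm_compute. Qed.

Definition cert_Q4X : cert := Cert pat_Q4X 13
  (masks [:: 1010010111100; 0101101011001; 1110010010110; 0011001110101; 0010111110100; 1011010010011; 1001111010010; 1101100001110; 1100001101101; 0111100001011; 1001110101010; 0100111101001; 0110001100111; 0000000000000]%dg)
  (codes [:: 0x0; 0x00; 0x100; 0x1010; 0x10110; 0x101010; 0x1010010; 0x01000110; 0x010110000; 0x0100001110; 0x01100111010; 0x010100011100; 0x1101100010010; 0x11111111111110]%dg)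
  (codes [:: 0x2; 0x12; 0x012; 0x0102; 0x01002; 0x010102; 0x0101102; 0x10111002; 0x101001112; 0x1011110002; 0x10011000102; 0x101011100012; 0x0010011101102; 0x00000000000000]%dg)
  [::]
  [::]
  (fun e => if e then [:: [::]; [::]; [::]; [::]; [::]; [::]; [::]; [::]; [::]; [::]; [::]; [::]; [::]; [::]] else [:: [::]; [::]; [::]; [::]; [::]; [::]; [::]; [::]; [::]; [::]; [::]; [::]; [::]; [::]])
  [:: (8, 9); (8, 10); (8, 11); (8, 12); (8, 0); (8, 1); (8, 2); (8, 3); (8, 4); (8, 5); (8, 6); (8, 7)]
  [:: ([::], digits 30323311211220, [:: Any; Any; Any; Any; Any; Any; Any; Any; Any; Any; Any; Any; Any; Any])]
  [::].
Lemma check_Q4X : check [:: pat_P5; pat_W4; pat_W5] cert_Q4X.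
Proof. by vm_compute. Qed.

Definition cert_Q4 : cert := Cert pat_Q4 5
  (masks [:: 000000101; 001010100; 010001001; 010000101; 001000101; 101010100; 101010010; 100110010; 100101010; 010101010; 010101001; 101011100; 010111001; 001110101; 110001101; 011000111; 111010110; 101110011; 110101110; 011101011; 000000000]%dg)
  (codes [:: 0x0; 0x10; 0x100; 0x1110; 0x11110; 0x110210; 0x0110210; 0x10010410; 0x100012110; 0x0112002110; 0x10112002410; 0x110112110000; 0x1011100011200; 0x11111110000100; 0x111110000110110; 0x1111110000111110; 0x11001111100101000; 0x010001111101000010; 0x0010001111101000020; 0x10110001111010100010; 0x111111111111111111110]%dg)
  (codes [:: 0x0; 0x00; 0x010; 0x0000; 0x00000; 0x001000; 0x1011100; 0x11111000; 0x111111000; 0x1101111000; 0x01000111000; 0x001000001112; 0x0100011100012; 0x00000001111012; 0x000001111001002; 0x0000001111000002; 0x00110000011010112; 0x101110000010111102; 0x1101110000010111102; 0x01001110000101011102; 0x000000000000000000000]%dg)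
  [:: (0, 0, 2); (1, 1, 2); (2, 2, 2); (3, 3, 2); (4, 4, 2); (5, 5, 2); (6, 6, 2); (7, 7, 2); (8, 8, 2); (9, 9, 2); (10, 10, 2)]
  [::]
  (fun e => if e then [:: [::]; [::]; [::]; [::]; [::]; [::]; [::]; [::]; [::]; [::]; [::]; [::]; [::]; [::]; [::]; [::]; [::]; [::]; [::]; [::]; [::]] else [:: [::]; [::]; [::]; [::]; [::]; [::]; [::]; [::]; [::]; [::]; [::]; [::]; [::]; [::]; [::]; [::]; [::]; [::]; [::]; [::]; [::]])
  [::]
  [:: ([:: 8], digits 221223330113122233110, [:: Any; Any; Any; Any; Any; Any; Any; Any; Any; Any; Any; Any; Any; Any; Any; Any; Any; Any; Any; Any; Any]); ([:: 7], digits 232223301113122233110, [:: Any; Any; Any; Any; Any; Any; Any; Any; Any; Any; Any; Any; Any; Any; Any; Any; Any; Any; Any; Any; Any]); ([:: 2], digits 220223331113122233110, [:: Any; Any; Any; Any; Any; Any; Any; Any; Any; Any; Any; Any; Any; Any; Any; Any; Any; Any; Any; Any; Any]); ([:: 1], digits 202223331113122233110, [:: Any; Any; Any; Any; Any; Any; Any; Any; Any; Any; Any; Any; Any; Any; Any; Any; Any; Any; Any; Any; Any])]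
  [:: 5].
Lemma check_Q4 : check [:: pat_P5; pat_W4; pat_W5; pat_ICO; pat_Q4X] cert_Q4.
Proof. by vm_compute. Qed.

Definition cert_Q4e : cert := Cert pat_Q4e 5
  (masks [:: 000000101; 001010100; 100010010; 000101010; 010001001; 010000101; 001000101; 101010100; 101010010; 010101010; 010101001; 101011100; 010111001; 011000111; 111010110; 101110101; 101110011; 110101110; 110101101; 011101011; 000000000; 101000000; 010100000]%dg)
  (codes [:: 0x0; 0x10; 0x110; 0x1110; 0x11110; 0x111010; 0x1101110; 0x11100210; 0x011110210; 0x0111120020; 0x10011120010; 0x111001121000; 0x1001111001200; 0x11001111001110; 0x111100111001000; 0x1110111110010120; 0x01110001110100100; 0x001110001110100020; 0x1101111001101100000; 0x10111100011010000120; 0x111111111111111111110; 0x1111111111111111110000; 0x11111111111111001111000]%dg)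
  (codes [:: 0x0; 0x00; 0x110; 0x1100; 0x01110; 0x001100; 0x0011000; 0x00011000; 0x100011100; 0x1100011100; 0x01100001100; 0x000110000112; 0x0110000110012; 0x00110000110002; 0x000011000110112; 0x0001000001101002; 0x10001110001011012; 0x110001110001011102; 0x0010000110010011112; 0x01000011100101111002; 0x000000000000000000000; 0x0000000000000000000000; 0x00000000000000000000000]%dg)
  [:: (0, 0, 2); (1, 1, 2); (2, 2, 2); (3, 3, 2); (4, 4, 2); (5, 5, 2); (6, 6, 2); (7, 7, 2); (8, 8, 2); (9, 9, 2); (10, 10, 2); (14, 22, 1); (15, 22, 1); (18, 21, 1); (19, 21, 1)]
  [::]
  (fun e => if e then [:: [::]; [::]; [::]; [::]; [::]; [::]; [::]; [::]; [::]; [::]; [::]; [::]; [::]; [::]; [::]; [::]; [::]; [::]; [::]; [::]; [::]; [::]; [::]] else [:: [::]; [::]; [::]; [::]; [::]; [::]; [::]; [::]; [::]; [::]; [::]; [::]; [::]; [::]; [::]; [::]; [::]; [::]; [::]; [::]; [::]; [::]; [::]])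
  [::]
  [:: ([:: 3; 9], digits 23301223301312303121000, [:: Any; Any; Any; Any; Any; Any; Any; Any; Any; Any; Any; Any; Any; Any; Any; Any; Any; Any; Any; Any; Any; Any; Any]); ([:: 2; 8], digits 23011223011312323101000, [:: Any; Any; Any; Any; Any; Any; Any; Any; Any; Any; Any; Any; Any; Any; Any; Any; Any; Any; Any; Any; Any; Any; Any]); ([:: 2; 3], digits 22001122331210223311000, [:: Any; Any; Any; Any; Any; Any; Any; Any; Any; Any; Any; Any; Any; Any; Any; Any; Any; Any; Any; Any; Any; Any; Any]); ([:: 0; 1; 6], digits 00322103322321313022000, [:: Any; Any; Any; Any; Any; Any; Any; Any; Any; Any; Any; Any; Any; Any; Any; Any; Any; Any; Any; Any; Any; Any; Any]); ([:: 0; 4; 5], digits 02230012233231220313000, [:: Any; Any; Any; Any; Any; Any; Any; Any; Any; Any; Any; Any; Any; Any; Any; Any; Any; Any; Any; Any; Any; Any; Any])]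
  [::].
Lemma check_Q4e : check [:: pat_P5; pat_W4; pat_W5; pat_ICO] cert_Q4e.
Proof. by vm_compute. Qed.

Definition cert_D123 : cert := Cert pat_D123 5
  (masks [:: 00010010; 00000101; 01010100; 01010010; 00110010; 00101010; 10001001; 10000101; 01000101; 01011100; 10110010; 10101010; 10101001; 10100101; 10111001; 11010110; 01110101; 01110011; 10101110; 11000111; 11101011; 00000000; 01000000; 10100000]%dg)
  (codes [:: 0x0; 0x10; 0x110; 0x1010; 0x11510; 0x110110; 0x1101000; 0x11501010; 0x011201110; 0x1121100110; 0x11611101610; 0x100211520010; 0x0100251120260; 0x11661011111210; 0x010001111001210; 0x1111110011000000; 0x11110011110000020; 0x101111000111000100; 0x1001111000121010020; 0x01100011110011201000; 0x000022220022221000100; 0x1111111111111111111100; 0x11111111111111111111000; 0x111111111111111001112000]%dg)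
  (codes [:: 0x0; 0x10; 0x000; 0x0100; 0x01000; 0x011000; 0x1011110; 0x10011100; 0x100111000; 0x0000011002; 0x01000111102; 0x011000011100; 0x1011100001100; 0x10011110001102; 0x101110000110002; 0x0000001100111112; 0x00001100001111102; 0x010000111000111012; 0x0110000111000101102; 0x10011100001100010112; 0x001000000100000111012; 0x0000000000000000000000; 0x00000000000000000000000; 0x000000000000000000000000]%dg)
  [:: (0, 0, 2); (0, 20, 1); (1, 1, 2); (1, 20, 1); (2, 2, 2); (3, 3, 2); (3, 20, 1); (4, 4, 2); (5, 5, 2); (6, 6, 2); (7, 7, 2); (8, 8, 2); (8, 20, 1); (11, 11, 2); (12, 12, 2); (15, 23, 1); (16, 23, 1)]
  [::]
  (fun e => if e then [:: [::]; [::]; [::]; [::]; [::]; [::]; [::]; [::]; [::]; [::]; [::]; [::]; [::]; [::]; [::]; [::]; [::]; [::]; [::]; [::]; [::]; [::]; [::]; [::]] else [:: [::]; [::]; [::]; [::]; [::]; [::]; [::]; [::]; [::]; [::]; [::]; [::]; [::]; [::]; [::]; [::]; [::]; [::]; [::]; [::]; [::]; [::]; [::]; [::]])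
  [::]
  [:: ([::], digits 212223111203303212313000, [:: Any; Any; Any; Any; Any; Any; Any; Any; Any; Any; Any; Any; Any; Any; Any; Any; Any; Any; Any; Any; Any; Any; Any; Any])]
  [::].
Lemma check_D123 : check [:: pat_P5; pat_W4; pat_W5; pat_ICO; pat_Q4; pat_Q4e] cert_D123.
Proof. by vm_compute. Qed.

Definition cert_G7 : cert := Cert pat_G7 5
  (masks [:: 0010100; 0010010; 0000101; 0011100; 0010110; 0010101; 1010100; 0101010; 1000101; 0011110; 1010110; 1010101; 0110011; 1001110; 1101001; 1111001; 0110111; 0101111; 1101110; 1100111; 1101111; 0000000; 0100000; 1100000]%dg)
  (codes [:: 0x0; 0x10; 0x100; 0x2110; 0x01010; 0x101100; 0x1111210; 0x01102010; 0x141121100; 0x2110212210; 0x21112101020; 0x101121041100; 0x1101101101100; 0x01100101100120; 0x000002024002010; 0x0010000110000220; 0x22212220222200000; 0x001002212002002200; 0x0100000100000012000; 0x10100110100100120000; 0x002002022002002200000; 0x1111111111111111011100; 0x11110111111011110111000; 0x111104111100111100112000]%dg)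
  (codes [:: 0x0; 0x00; 0x010; 0x0002; 0x00000; 0x000000; 0x0010012; 0x10110110; 0x010000110; 0x0011011112; 0x00000020102; 0x000000110112; 0x0010010010012; 0x11111111111102; 0x110110100114100; 0x1101111001111002; 0x00000001000010112; 0x110101101201110022; 0x1011111011110100012; 0x01001001001011001112; 0x110001100201010022112; 0x0000000000000000000000; 0x00000000000000000000000; 0x000000000000000000000000]%dg)
  [:: (0, 0, 2); (0, 4, 1); (1, 1, 2); (1, 5, 1); (1, 11, 1); (2, 2, 2); (2, 4, 1); (2, 14, 1); (4, 0, 2); (4, 2, 1); (4, 4, 2); (4, 5, 1); (4, 22, 1); (4, 23, 1); (5, 1, 1); (5, 4, 1); (5, 5, 2); (7, 7, 2); (8, 8, 2); (14, 2, 1); (14, 14, 2)]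
  [:: (3, 19, 19, (2, 0)); (3, 19, 20, (2, 0)); (3, 20, 20, (2, 0)); (18, 12, 12, (2, 0)); (18, 12, 16, (2, 0)); (18, 16, 16, (2, 0))]
  (fun e => if e then [:: [::]; [::]; [::]; [::]; [::]; [::]; [::]; [::]; [::]; [::]; [::]; [:: (12, 18, 2)]; [::]; [::]; [::]; [::]; [::]; [::]; [::]; [::]; [::]; [::]; [::]; [::]] else [:: [::]; [::]; [::]; [::]; [::]; [::]; [::]; [::]; [::]; [::]; [::]; [::]; [::]; [::]; [::]; [::]; [::]; [::]; [::]; [::]; [::]; [::]; [::]; [::]])
  [::]
  [:: ([::], digits 212112032010103300320000, [:: Any; Any; Any; Top [:: 19; 20]; Any; Any; Any; Any; Any; Any; Self 0; Any; Self 6; Any; Any; Any; Any; Any; Top [:: 12; 16]; Self 5; Any; Any; Any; Any])]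
  [::].
Lemma check_G7 : check [:: pat_P5; pat_W4; pat_W5; pat_D123] cert_G7.
Proof. by vm_compute. Qed.

Definition cert_G6 : cert := Cert pat_G6 5
  (masks [:: 0001010; 0000101; 0010110; 0110100; 0110010; 1001001; 0111100; 1011001; 1010110; 0110110; 0110011; 0101111; 1101110; 1100111; 1101111; 0000000; 1100000]%dg)
  (codes [:: 0x0; 0x10; 0x110; 0x0120; 0x10220; 0x110000; 0x0112100; 0x11000200; 0x112110100; 0x0044401010; 0x10112010110; 0x111001024000; 0x1000110200400; 0x01010142000000; 0x220002020000000; 0x1111111110111100; 0x11011111001011200]%dg)
  (codes [:: 0x0; 0x10; 0x000; 0x1000; 0x01000; 0x001110; 0x1000012; 0x00111012; 0x000001012; 0x0000010100; 0x01000101002; 0x000110100112; 0x0111001011012; 0x10101000111112; 0x001110404041112; 0x0000000000000000; 0x00000000000000000]%dg)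
  [:: (0, 0, 2); (0, 9, 1); (1, 1, 2); (1, 9, 1); (2, 2, 2); (2, 16, 1); (3, 3, 2); (4, 4, 2); (5, 5, 2); (8, 16, 1); (9, 9, 2); (9, 14, 4)]
  [::]
  (fun e => if e then [:: [::]; [::]; [::]; [::]; [::]; [::]; [::]; [::]; [::]; [::]; [::]; [::]; [::]; [::]; [::]; [::]; [::]] else [:: [::]; [::]; [::]; [::]; [::]; [::]; [::]; [::]; [::]; [::]; [::]; [::]; [::]; [::]; [::]; [::]; [::]])
  [::]
  [:: ([::], digits 21333232333021000, [:: Any; Any; Any; Any; Any; Any; Any; Any; Any; Any; Any; Any; Any; Any; Any; Any; Any])]
  [::].
Lemma check_G6 : check [:: pat_P5; pat_W4; pat_W5; pat_G7] cert_G6.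
Proof. by vm_compute. Qed.

Definition cert_G5 : cert := Cert pat_G5 5
  (masks [:: 0001010; 0000101; 0110100; 0110010; 1001010; 1001001; 1000101; 0111100; 1011001; 0110110; 1110100; 0110011; 1110010; 1110110; 1101110; 1100111; 1101111; 0000000; 1000000; 0100000; 1100000]%dg)
  (codes [:: 0x0; 0x10; 0x010; 0x1020; 0x10020; 0x110010; 0x0120210; 0x01210010; 0x110012100; 0x0044202100; 0x04122041020; 0x101210010110; 0x4021402102210; 0x00220001020100; 0x100111002004100; 0x0110011420100000; 0x22002220200000000; 0x111111111011101100; 0x1111111110111011000; 0x11111111101110110000; 0x111111111211101100000]%dg)
  (codes [:: 0x0; 0x10; 0x100; 0x0100; 0x01100; 0x001100; 0x1001100; 0x10001102; 0x001100012; 0x0000010010; 0x11001100142; 0x010001101002; 0x1100011014202; 0x00000100102022; 0x011000110110012; 0x1001100001011112; 0x00110004051414112; 0x000000000000000000; 0x0000000000000000000; 0x00000000000000000000; 0x000000000000000000000]%dg)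
  [:: (0, 0, 2); (0, 9, 1); (0, 13, 1); (1, 1, 2); (1, 9, 1); (1, 13, 1); (2, 2, 2); (3, 3, 2); (4, 4, 2); (4, 13, 1); (5, 5, 2); (6, 6, 2); (6, 13, 1); (9, 9, 2)]
  [::]
  (fun e => if e then [:: [::]; [::]; [::]; [::]; [::]; [::]; [::]; [::]; [::]; [::]; [::]; [::]; [::]; [::]; [::]; [::]; [::]; [::]; [::]; [::]; [::]] else [:: [::]; [::]; [::]; [::]; [::]; [::]; [::]; [::]; [::]; [::]; [::]; [::]; [::]; [::]; [::]; [::]; [::]; [::]; [::]; [:: (9, 9, 2); (9, 13, 2)]; [::]])
  [::]
  [:: ([:: 12], digits 213322132313032100000, [:: Any; Any; Any; Any; Any; Any; Any; Any; Any; Any; Any; Any; Any; Any; Any; Any; Any; Any; Any; Any; Any]); ([:: 10], digits 213321131303232100000, [:: Any; Any; Any; Any; Any; Any; Any; Any; Any; Any; Any; Any; Any; Any; Any; Any; Any; Any; Any; Any; Any])]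
  [::].
Lemma check_G5 : check [:: pat_P5; pat_W4; pat_W5; pat_G7; pat_G6] cert_G5.
Proof. by vm_compute. Qed.

Definition cert_G2 : cert := Cert pat_G2 5
  (masks [:: 0001010; 0001001; 0011001; 1010010; 0001110; 0100101; 1110100; 1101001; 0100111; 1111100; 1110011; 1101101; 1101011; 0000000; 0100000]%dg)
  (codes [:: 0x0; 0x10; 0x120; 0x1000; 0x21110; 0x041000; 0x0004020; 0x11101100; 0x011002110; 0x0001012020; 0x10014010020; 0x021602201000; 0x2212100000000; 0x11111111111000; 0x111111111110000]%dg)
  (codes [:: 0x0; 0x00; 0x002; 0x0110; 0x00002; 0x100110; 0x1110100; 0x00010012; 0x100110002; 0x1110100102; 0x01100101102; 0x100110610112; 0x0000011111122; 0x00000000000000; 0x000000000000000]%dg)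
  [:: (0, 0, 2); (1, 1, 2); (3, 3, 2); (5, 5, 2); (6, 6, 2)]
  [::]
  (fun e => if e then [:: [::]; [::]; [::]; [::]; [::]; [::]; [::]; [::]; [::]; [::]; [::]; [::]; [::]; [::]; [::]] else [:: [::]; [::]; [::]; [::]; [::]; [::]; [::]; [::]; [::]; [::]; [::]; [::]; [::]; [::]; [::]])
  [::]
  [:: ([::], digits 122312322330000, [:: Any; Any; Any; Any; Any; Any; Any; Any; Any; Any; Any; Any; Any; Any; Any])]
  [::].
Lemma check_G2 : check [:: pat_P5; pat_W4; pat_W5; pat_G7; pat_G6; pat_G5] cert_G2.
Proof. by vm_compute. Qed.

Definition cert_G8a : cert := Cert pat_G8a 5
  (masks [:: 010001010; 100001001; 001110100; 010110010; 010101010; 101001001; 101000101; 001111100; 110011001; 010110011; 110001110; 011101010; 101101001; 101000111; 110110110; 111010101; 000000000]%dg)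
  (codes [:: 0x0; 0x10; 0x000; 0x1040; 0x10210; 0x012020; 0x0140010; 0x00210010; 0x110011100; 0x1012100100; 0x11011100110; 0x110120001110; 0x1100021010100; 0x01100121100010; 0x101110010101000; 0x0110011100001100; 0x11111111111111110]%dg)
  (codes [:: 0x0; 0x00; 0x110; 0x0100; 0x00100; 0x001100; 0x1001100; 0x11001102; 0x001100012; 0x0100011012; 0x00100011002; 0x001001110002; 0x0011100101012; 0x10011000011102; 0x010001101010112; 0x1001100011110012; 0x00000000000000000]%dg)
  [:: (0, 0, 2); (0, 5, 1); (1, 1, 2); (1, 4, 1); (2, 2, 2); (3, 3, 2); (4, 1, 1); (4, 4, 2); (5, 0, 1); (5, 5, 2); (6, 6, 2)]
  [::]
  (fun e => if e then [:: [::]; [::]; [::]; [::]; [::]; [::]; [::]; [::]; [::]; [::]; [::]; [::]; [::]; [::]; [::]; [::]; [::]] else [:: [::]; [::]; [::]; [::]; [::]; [::]; [::]; [::]; [::]; [::]; [::]; [::]; [::]; [::]; [::]; [::]; [::]])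
  [::]
  [:: ([::], digits 12331223131122320, [:: Any; Any; Any; Any; Any; Any; Any; Any; Any; Any; Any; Any; Any; Any; Any; Any; Any])]
  [::].
Lemma check_G8a : check [:: pat_P5; pat_W4; pat_W5; pat_D123; pat_G7; pat_G6; pat_G5; pat_G2] cert_G8a.
Proof. by vm_compute. Qed.

Definition cert_G8b : cert := Cert pat_G8b 5
  (masks [:: 010001010; 100001001; 001110100; 010110010; 011001010; 010101010; 101001001; 100101001; 101000101; 001111100; 110011001; 010110011; 110001110; 101000111; 110110110; 111010101; 000000000]%dg)
  (codes [:: 0x0; 0x00; 0x000; 0x1040; 0x21010; 0x100110; 0x0100000; 0x12001010; 0x014000110; 0x0021000010; 0x11001111100; 0x101211000100; 0x1101111100110; 0x01100011211000; 0x101111000101000; 0x0110001111000100; 0x11111111111111110]%dg)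
  (codes [:: 0x0; 0x00; 0x110; 0x0100; 0x00102; 0x001000; 0x0011110; 0x00110102; 0x100111000; 0x1100111102; 0x00110000012; 0x010000111012; 0x0010000011002; 0x10011100000112; 0x010000111010112; 0x1001110000111012; 0x00000000000000000]%dg)
  [:: (0, 0, 2); (0, 1, 1); (0, 6, 1); (1, 0, 1); (1, 1, 2); (1, 5, 1); (2, 2, 2); (3, 3, 2); (5, 1, 1); (5, 5, 2); (6, 0, 1); (6, 6, 2); (8, 8, 2)]
  [::]
  (fun e => if e then [:: [::]; [::]; [::]; [::]; [::]; [::]; [::]; [::]; [::]; [::]; [::]; [::]; [::]; [::]; [::]; [::]; [::]] else [:: [::]; [::]; [::]; [::]; [::]; [::]; [::]; [::]; [::]; [::]; [::]; [::]; [::]; [::]; [::]; [::]; [::]])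
  [::]
  [:: ([::], digits 12331122231312320, [:: Any; Any; Any; Any; Any; Any; Any; Any; Any; Any; Any; Any; Any; Any; Any; Any; Any])]
  [::].
Lemma check_G8b : check [:: pat_P5; pat_W4; pat_W5; pat_D123; pat_G7; pat_G6; pat_G5; pat_G2] cert_G8b.
Proof. by vm_compute. Qed.

Definition cert_G8 : cert := Cert pat_G8 5
  (masks [:: 0010100; 0011100; 0010110; 0010101; 0110010; 0101010; 1001001; 1000101; 0111010; 0110011; 1001101; 1000111; 1111001; 1110110; 1110101; 1101110; 0000000; 1000000; 0100000; 1100000]%dg)
  (codes [:: 0x0; 0x20; 0x110; 0x1110; 0x01520; 0x004410; 0x0044090; 0x01250010; 0x000211000; 0x1110210010; 0x00200011400; 0x110100120010; 0x0000011100120; 0x21222200210000; 0x212200220021000; 0x0000111012002000; 0x11111111111110010; 0x111511110111100100; 0x1151111111011001000; 0x11001111212110010000]%dg)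
  (codes [:: 0x0; 0x02; 0x000; 0x0000; 0x00000; 0x110100; 0x11101a0; 0x00001100; 0x010104512; 0x0001001102; 0x01101540112; 0x001011001102; 0x1111100011002; 0x00000015001112; 0x000051001100122; 0x1111000100110112; 0x00000000000000000; 0x000000000000000000; 0x0000000000000000000; 0x00000000000000000000]%dg)
  [:: (0, 0, 2); (0, 4, 1); (0, 7, 1); (0, 8, 1); (0, 10, 1); (2, 2, 2); (2, 8, 1); (2, 19, 1); (3, 3, 2); (3, 10, 1); (3, 19, 1); (4, 0, 1); (4, 4, 2); (5, 5, 2); (6, 6, 2); (7, 0, 1); (7, 7, 2); (8, 0, 1); (8, 2, 1); (8, 17, 1); (10, 0, 1); (10, 3, 1); (10, 18, 1)]
  [::]
  (fun e => if e then [:: [::]; [::]; [::]; [::]; [::]; [::]; [::]; [::]; [::]; [::]; [::]; [::]; [::]; [::]; [::]; [::]; [::]; [:: (8, 14, 2)]; [:: (10, 13, 2)]; [::]] else [:: [::]; [::]; [::]; [::]; [::]; [::]; [::]; [::]; [::]; [::]; [::]; [::]; [::]; [::]; [::]; [::]; [::]; [::]; [::]; [::]])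
  [::]
  [:: ([:: 6; 10], digits 11112203220330120000, [:: Any; Any; Any; Any; Any; Any; Any; Any; Any; Any; Any; Any; Any; Any; Any; Any; Any; Any; Any; Any]); ([:: 5; 8], digits 22221033013332010000, [:: Any; Any; Any; Any; Any; Any; Any; Any; Any; Any; Any; Any; Any; Any; Any; Any; Any; Any; Any; Any]); ([:: 2; 3; 4; 6; 8], digits 11000203013320320000, [:: Any; Any; Any; Any; Any; Any; Any; Any; Any; Any; Any; Any; Any; Any; Any; Any; Any; Any; Any; Any]); ([:: 0; 2; 3; 6; 8], digits 01001203013320320000, [:: Any; Any; Any; Any; Any; Any; Any; Any; Any; Any; Any; Any; Any; Any; Any; Any; Any; Any; Any; Any]); ([:: 2; 3; 5; 7; 10], digits 11003020330123020000, [:: Any; Any; Any; Any; Any; Any; Any; Any; Any; Any; Any; Any; Any; Any; Any; Any; Any; Any; Any; Any]); ([:: 0; 2; 3; 5; 10], digits 01003021330123020000, [:: Any; Any; Any; Any; Any; Any; Any; Any; Any; Any; Any; Any; Any; Any; Any; Any; Any; Any; Any; Any])]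
  [:: 1; 2; 4].
Lemma check_G8 : check [:: pat_P5; pat_W4; pat_W5; pat_D123; pat_G7; pat_G6; pat_G5; pat_G2; pat_G8a; pat_G8b] cert_G8.
Proof. by vm_compute. Qed.

Definition cert_T13 : cert := Cert pat_T13 5
  (masks [:: 00010100; 00011100; 00110010; 01000101; 10010110; 10010101; 00110011; 01101010; 01101001; 01000111; 10111010; 01111001; 11010110; 10110101; 01101110; 11001101; 00000000; 01100000; 11100000]%dg)
  (codes [:: 0x0; 0x20; 0x110; 0x1100; 0x11420; 0x112490; 0x1120100; 0x00422010; 0x002402090; 0x1102010010; 0x00102212200; 0x000100012100; 0x1110211000100; 0x11011200010020; 0x001000121012000; 0x0001220221310100; 0x11111111111111110; 0x111100111101001000; 0x1111001111010010000]%dg)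
  (codes [:: 0x0; 0x02; 0x000; 0x0010; 0x00010; 0x001000; 0x0001012; 0x11011100; 0x111011100; 0x0010101102; 0x11010100112; 0x111011100012; 0x0001000111012; 0x00100011101102; 0x110111000100112; 0x1110101100101012; 0x00000000000000000; 0x000000000000000000; 0x0000000000000000000]%dg)
  [:: (0, 0, 2); (2, 2, 2); (3, 3, 2); (4, 4, 2); (4, 17, 1); (4, 18, 1); (5, 5, 2); (5, 17, 1); (5, 18, 1); (7, 7, 2); (8, 8, 2); (10, 17, 1); (10, 18, 1); (12, 17, 1); (12, 18, 1); (13, 17, 1); (13, 18, 1); (15, 17, 1); (15, 18, 1)]
  [::]
  (fun e => if e then [:: [::]; [::]; [::]; [::]; [::]; [::]; [::]; [::]; [::]; [::]; [::]; [::]; [::]; [::]; [::]; [::]; [::]; [::]; [::]] else [:: [::]; [::]; [::]; [::]; [::]; [::]; [::]; [::]; [::]; [::]; [::]; [::]; [::]; [::]; [::]; [::]; [::]; [::]; [::]])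
  [::]
  [:: ([::], digits 2213221133132213000, [:: Any; Any; Any; Any; Any; Any; Any; Any; Any; Any; Any; Any; Any; Any; Any; Any; Any; Any; Any])]
  [::].
Lemma check_T13 : check [:: pat_P5; pat_W4; pat_W5; pat_D123; pat_G7; pat_G6; pat_G5; pat_G2; pat_G8] cert_T13.
Proof. by vm_compute. Qed.

Definition cert_G1 : cert := Cert pat_G1 5
  (masks [:: 0010010; 0001010; 0011010; 0110100; 0110010; 1001010; 1001001; 1000101; 0100101; 0111100; 1011010; 0111010; 1011001; 0110011; 1001110; 1110110; 1101011; 1100111; 0000000; 1000000; 0100000; 1100000]%dg)
  (codes [:: 0x0; 0x10; 0x110; 0x0000; 0x11140; 0x111020; 0x0000040; 0x10040210; 0x010120410; 0x1002100110; 0x11102122000; 0x111212002020; 0x0100012110000; 0x11112100011100; 0x111012100011120; 0x2722200021020100; 0x72200222002010100; 0x000100111200200000; 0x1111111111111110010; 0x11111111111911100100; 0x111111111191111001000; 0x1191111111221110010000]%dg)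
  (codes [:: 0x0; 0x00; 0x000; 0x0100; 0x00000; 0x000100; 0x1001100; 0x11101100; 0x111011000; 0x0110011002; 0x05050041112; 0x500400511102; 0x1011100001112; 0x00000011100012; 0x000100011100002; 0x0000071700201012; 0x00017000710201012; 0x111011000011011112; 0x0000000000000000000; 0x00000000000000000000; 0x000000000000000000000; 0x0000000000000000000000]%dg)
  [:: (0, 0, 2); (0, 3, 1); (1, 1, 2); (1, 6, 1); (2, 2, 2); (2, 3, 1); (2, 6, 1); (3, 0, 1); (3, 2, 1); (3, 3, 2); (4, 4, 2); (5, 5, 2); (6, 1, 1); (6, 2, 1); (6, 6, 2); (7, 7, 2); (8, 8, 2)]
  [::]
  (fun e => if e then [:: [::]; [::]; [::]; [::]; [::]; [::]; [::]; [::]; [::]; [::]; [::]; [::]; [::]; [::]; [::]; [::]; [::]; [::]; [::]; [::]; [::]; [::]] else [:: [::]; [::]; [::]; [::]; [::]; [::]; [::]; [::]; [::]; [::]; [::]; [::]; [::]; [::]; [::]; [::]; [::]; [::]; [::]; [::]; [::]; [::]])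
  [::]
  [:: ([:: 11], digits 2221123331203121230000, [:: Any; Any; Any; Any; Any; Any; Any; Any; Any; Any; Any; Any; Any; Any; Any; Any; Any; Any; Any; Any; Any; Any]); ([:: 10], digits 1113122333012121230000, [:: Any; Any; Any; Any; Any; Any; Any; Any; Any; Any; Any; Any; Any; Any; Any; Any; Any; Any; Any; Any; Any; Any]); ([:: 8], digits 1113122303012121230000, [:: Any; Any; Any; Any; Any; Any; Any; Any; Any; Any; Any; Any; Any; Any; Any; Any; Any; Any; Any; Any; Any; Any])]
  [::].
Lemma check_G1 : check [:: pat_P5; pat_W4; pat_W5; pat_D123; pat_G7; pat_G6; pat_G5; pat_G2; pat_T13] cert_G1.
Proof. by vm_compute. Qed.

Definition cert_D1 : cert := Cert pat_D1 5
  (masks [:: 010100; 010010; 001010; 000101; 011100; 011010; 010110; 010101; 010011; 101010; 101001; 100101; 111001; 110110; 101110; 100111; 000000; 100000]%dg)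
  (codes [:: 0x0; 0x00; 0x010; 0x1010; 0x21010; 0x011000; 0x55bb190; 0x10011b90; 0x121011100; 0x0b10052010; 0x00000000090; 0xb00110250290; 0x0011000001210; 0x22771222100000; 0x011001005210200; 0x1001500100122000; 0x11111101111110110; 0x11111a0a1111101100]%dg)
  (codes [:: 0x0; 0x00; 0x100; 0x0110; 0x00102; 0x000110; 0x0000000; 0x00100100; 0x000100012; 0x100110b100; 0x11001010100; 0x011001b01100; 0x1100111110002; 0x00000000071712; 0x100110110001012; 0x0110011011000112; 0x00000000000000000; 0x000000000000000000]%dg)
  [:: (0, 0, 2); (0, 1, 1); (0, 5, 1); (1, 0, 1); (1, 1, 2); (1, 7, 1); (2, 2, 2); (2, 10, 1); (3, 3, 2); (3, 10, 1); (5, 0, 1); (5, 5, 2); (5, 10, 1); (6, 6, 2); (7, 1, 1); (7, 7, 2); (7, 10, 1); (9, 9, 2); (10, 2, 1); (10, 3, 1); (10, 5, 1); (10, 7, 1); (10, 10, 2); (11, 11, 2)]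
  [::]
  (fun e => if e then [:: [::]; [::]; [::]; [::]; [::]; [::]; [::]; [::]; [::]; [::]; [::]; [::]; [::]; [::]; [::]; [::]; [::]; [::]] else [:: [::]; [::]; [::]; [::]; [::]; [::]; [::]; [::]; [::]; [::]; [::]; [::]; [::]; [::]; [::]; [::]; [::]; [::]])
  [::]
  [:: ([::], digits 211221121332313200, [:: Any; Any; Any; Any; Any; Any; Any; Any; Any; Any; Any; Any; Any; Any; Any; Any; Any; Any])]
  [::].
Lemma check_D1 : check [:: pat_P5; pat_W4; pat_W5; pat_D123; pat_G7; pat_G6; pat_G5; pat_G2; pat_G8; pat_T13; pat_G1] cert_D1.
Proof. by vm_compute. Qed.

Definition cert_A1 : cert := Cert pat_A1 5
  (masks [:: 001010; 001001; 000101; 011001; 110100; 110010; 001110; 101001; 000111; 111100; 110011; 001111; 111110; 110111; 000000]%dg)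
  (codes [:: 0x0; 0x40; 0x040; 0x1210; 0x00400; 0x400040; 0x2101010; 0x12120010; 0x012110010; 0x0010210000; 0x10001200020; 0x232200020000; 0x2000220000200; 0x00202200020020; 0x111111111110000]%dg)
  (codes [:: 0x0; 0x00; 0x100; 0x0002; 0x11010; 0x011100; 0x0010102; 0x00001102; 0x100001102; 0x1101001102; 0x01110001102; 0x404011101002; 0x4111401101022; 0x11410401101202; 0x000000000000000]%dg)
  [:: (0, 0, 2); (1, 1, 2); (2, 2, 2); (4, 4, 2); (5, 5, 2)]
  [:: (6, 10, 10, (2, 0)); (6, 10, 13, (2, 0)); (6, 13, 13, (2, 0)); (8, 9, 9, (2, 0)); (8, 9, 12, (2, 0)); (8, 12, 12, (2, 0))]
  (fun e => if e then [:: [::]; [::]; [::]; [::]; [::]; [::]; [::]; [::]; [::]; [::]; [::]; [::]; [::]; [::]; [::]] else [:: [::]; [::]; [::]; [::]; [::]; [::]; [::]; [::]; [::]; [::]; [::]; [::]; [::]; [::]; [:: (12, 13, 1)]])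
  [::]
  [:: ([::], digits 221233221330000, [:: Any; Any; Any; Any; Any; Any; Top [:: 10; 13]; Any; Top [:: 9; 12]; Self 2; Self 5; Any; Any; Any; Any])]
  [::].
Lemma check_A1 : check [:: pat_P5; pat_W4; pat_W5; pat_D1] cert_A1.
Proof. by vm_compute. Qed.

Definition cert_C7c : cert := Cert pat_C7c 7
  (masks [:: 1110000; 1100001; 1000011; 0111000; 0011100; 0001110; 0000111; 1111010; 1110101; 1101011; 1011110; 1010111; 0111101; 0101111; 0000000]%dg)
  (codes [:: 0x0; 0x10; 0x210; 0x1230; 0x23310; 0x332210; 0x3213210; 0x11011000; 0x111100020; 0x1110001020; 0x00011110000; 0x011001100200; 0x1001110200200; 0x00101110002200; 0x111111111111110]%dg)
  (codes [:: 0x0; 0x00; 0x300; 0x0310; 0x31100; 0x113300; 0x1301300; 0x00100112; 0x000011102; 0x0001110102; 0x11100001332; 0x100110031012; 0x0110001013032; 0x11010003310012; 0x000000000000000]%dg)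
  [:: (0, 0, 2); (1, 1, 2); (2, 2, 2); (3, 3, 2); (4, 4, 2); (5, 5, 2); (6, 6, 2)]
  [::]
  (fun e => if e then [:: [::]; [::]; [::]; [::]; [::]; [::]; [::]; [::]; [::]; [::]; [::]; [::]; [::]; [::]; [::]] else [:: [::]; [::]; [::]; [::]; [::]; [::]; [::]; [::]; [::]; [::]; [::]; [::]; [::]; [::]; [::]])
  [::]
  [:: ([:: 6], digits 333222303321210, [:: Any; Any; Any; Any; Any; Any; Any; Any; Any; Any; Any; Any; Any; Any; Any]); ([:: 5], digits 322330230212310, [:: Any; Any; Any; Any; Any; Any; Any; Any; Any; Any; Any; Any; Any; Any; Any]); ([:: 4], digits 331302133021210, [:: Any; Any; Any; Any; Any; Any; Any; Any; Any; Any; Any; Any; Any; Any; Any])]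
  [::].
Lemma check_C7c : check [:: pat_P5; pat_W4; pat_C5] cert_C7c.
Proof. by vm_compute. Qed.

Lemma size_tri (G : sgraph) (s : seq G) : size (tri s) = size s.
Proof. by elim: s => //= x s ->. Qed.

(** * Patterns and induced subgraphs *)

Section Contains.
Variable G : sgraph.

Lemma contains_dec p : contains G p \/ ~ contains G p.
Proof.
have [/existsP[t /eqP e]|no] := boolP [exists t : (size p).-tuple G, tri t == p].
  by left; exists t.
right=> -[s e]; case/existsP: no; have sz : size s == size p by rewrite -e size_tri.
by exists (Tuple sz); rewrite /= e.
Qed.

(** Distinct rows mean that the pattern has no true twins, while a repeated vertex would repeat its
    row. *)
Lemma tri_uniq (s : seq G) p : uniq (full p) -> tri s = p -> uniq s.
Proof. by move=> u e; move: u; rewrite -e full_tri; apply: map_uniq. Qed.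

Lemma tri_map (H : sgraph) (f : H -> G) (es : seq H) :
  injective f -> (forall x y, adj (f x) (f y) = adj x y) ->
  tri (map f es) = tri es.
Proof.
move=> fi fa; elim: es => //= x es ->; congr (_ :: _).
by rewrite /trace -map_comp; apply: eq_map => y; rewrite /= /radj fa inj_eq.
Qed.

Lemma contains_induced (H : sgraph) (es : seq H) :
  has_induced G H -> contains G (tri es).
Proof.
move=> [S [f [g fK gK] fa]]; exists (map (val \o g) es); apply: tri_map.
  by apply: inj_comp; [exact: val_inj|exact: can_inj gK].
by move=> x y; rewrite -{2}(gK x) -{2}(gK y) fa.
Qed.

Lemma embedding_induced (H : sgraph) (f : H -> G) : injective f ->
  (forall x y, adj (f x) (f y) = adj x y) -> has_induced G H.
Proof.
move=> fi fa; exists (f @: setT).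
have hP (u : {x : G | x \in f @: setT}) : exists x, f x == val u.
  by have /imsetP[x _ e] := valP u; exists x; rewrite e.
pose h u := xchoose (hP u); have hK u : f (h u) = val u by exact/eqP/(xchooseP (hP u)).
exists h; last by move=> x y; rewrite -fa !hK.
have fS x : f x \in f @: setT by apply: imset_f.
exists (fun x => exist _ (f x) (fS x)) => [u|x]; first by apply: val_inj; rewrite /= hK.
by apply: fi; rewrite hK.
Qed.

Lemma tri_radj (H : sgraph) (s : seq G) (es : seq H) i j d d' : tri s = tri es ->
  i < size es -> j < size es -> radj (nth d s i) (nth d s j) = radj (nth d' es i) (nth d' es j).
Proof.
move=> e; have ss : size s = size es by rewrite -(size_tri s) e size_tri.
have := congr1 full e; rewrite !full_tri => er il jl.
have rw (K : sgraph) (t : seq K) dd : i < size t -> j < size t ->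
    nth false (nth [::] (rows t) i) j = radj (nth dd t i) (nth dd t j).
  by move=> it jt; rewrite (nth_map dd) // (nth_map dd).
by rewrite -!rw ?ss // er.
Qed.

Lemma induced_contains (H : sgraph) (es : seq H) : (forall x, x \in es) ->
  uniq (full (tri es)) -> contains G (tri es) -> has_induced G H.
Proof.
move=> ae u [s e]; have us := tri_uniq u e; have ss : size s = size es.
  by rewrite -(size_tri s) e size_tri.
case: es ae u e ss => [|d0 es'] ae u e ss.
  pose f (x : H) : G := False_rect G (notF (ae x)).
  by apply: (@embedding_induced _ f) => x; case: (notF (ae x)).
case: s e us ss => [|d s'] e us ss //.
set es := d0 :: es' in ae u e ss.
pose f x := nth d (d :: s') (index x es).
have il x : index x es < size es by rewrite index_mem.
have fi : injective f.
  move=> x y /eqP; rewrite /f nth_uniq ?ss // => /eqP h.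
  by rewrite -[x](nth_index x (ae x)) h nth_index.
apply: (embedding_induced fi) => x y.
have := tri_radj d x e (il x) (il y); rewrite !nth_index // -/(f x) -/(f y).
rewrite /radj (inj_eq fi); case: eqVneq => [->|] //.
by rewrite !adj_irr.
Qed.
End Contains.

Definition ord5 := [:: Ordinal (isT : 0 < 5); Ordinal (isT : 1 < 5); Ordinal (isT : 2 < 5);
  Ordinal (isT : 3 < 5); Ordinal (isT : 4 < 5)].
Definition ord4 := [:: Ordinal (isT : 0 < 4); Ordinal (isT : 1 < 4); Ordinal (isT : 2 < 4);
  Ordinal (isT : 3 < 4)].
Definition ord7 := [:: Ordinal (isT : 0 < 7); Ordinal (isT : 1 < 7); Ordinal (isT : 2 < 7);
  Ordinal (isT : 3 < 7); Ordinal (isT : 4 < 7); Ordinal (isT : 5 < 7); Ordinal (isT : 6 < 7)].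

Lemma P5_tri : @tri (path_graph 5) ord5 = pat_P5. Proof. by vm_compute. Qed.
Lemma C5_tri : @tri (cycle_graph 5) ord5 = pat_C5. Proof. by vm_compute. Qed.
Lemma C7c_tri : @tri (compl (cycle_graph 7)) ord7 = pat_C7c. Proof. by vm_compute. Qed.
Lemma W4_tri : @tri (wheel 4) (rcons (map some ord4) None) = pat_W4. Proof. by vm_compute. Qed.
Lemma W5_tri : @tri (wheel 5) (None :: map some ord5) = pat_W5. Proof. by vm_compute. Qed.

Section Zero.
Variable G : sgraph.

Definition zeros (s : seq G) x := ~~ has id (trace s x).

Definition clean (Z : pred G) : Prop :=
  [/\ forall q r s, Z q -> Z r -> Z s -> radj q r -> radj r s -> radj q s,
      forall x q r, ~~ Z x -> Z q -> Z r -> radj q r -> radj x q -> radj x r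
    & forall q, Z q -> exists x y,
        [/\ ~~ Z x /\ ~~ Z y, radj q x, radj q y & ~~ radj x y]].

Lemma core_clean pats p s s0 : (forall p, p \in pats -> ~ contains G p) ->
  all wf pats -> pat_W4 \in pats -> tri s = p -> s0 \in s -> check_core pats p ->
  connected G -> atom G -> clean (zeros s).
Proof.
move=> free wfs W4 ts s0s ok Gc Ga.
have hom := core_hom free wfs ts s0s ok Gc Ga.
have nbr := core_nbr free wfs ts s0s ok Gc Ga.
(* Two nonadjacent neighbours x, y of r are adjacent to q and t by homogeneity, so q, x, t, y is the
   rim of a 4-wheel with hub r. *)
split=> // q r t qZ rZ tZ qr rt; apply/negPn/negP => qt.
have [x [y [[xZ yZ] rx ry xy]]] := nbr r rZ.
rewrite radj_sym in rx; rewrite radj_sym in ry.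
case: (free _ W4); exists [:: q; x; t; y; r].
have xq : radj x q by apply: (hom x r q); rewrite // radj_sym.
have yq : radj y q by apply: (hom y r q); rewrite // radj_sym.
have xt : radj x t by apply: (hom x r t).
have yt : radj y t by apply: (hom y r t).
rewrite /= /trace /= (radj_sym q x) (radj_sym q y) (radj_sym t y) (negPf qt) (negPf xy).
by rewrite xq yq xt yt qr rx ry (radj_sym t r) rt.
Qed.

Lemma zerosP s x : reflect (forall y, y \in s -> ~~ radj x y) (zeros s x).
Proof.
apply: (iffP hasPn) => h y; first by move=> ys; apply: (h (radj x y)); apply: map_f.
by move=> /mapP[z /h nz ->].
Qed.

(** The new case is an [x] coreless for [s] but not for [t]; it has no neighbour [q] coreless for
    [t]. Indeed [x] has a neighbour y in [t], and y, or else the [w] attached to y, has neighbours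
    in [s]. Homogeneity carries the adjacency of that vertex through [x] to [q], although [q] has no
    neighbour in [t]. *)
Lemma clean_extend (s t : seq G) : {subset s <= t} -> clean (zeros s) ->
  (forall y, y \in t -> zeros s y ->
     exists2 w, w \in t & radj y w && ~~ zeros s w) ->
  clean (zeros t).
Proof.
move=> st [tr hom nbr] ex.
have zz x : zeros t x -> zeros s x.
  by move=> /zerosP h; apply/zerosP => y /st/h.
have nn x : ~~ zeros s x -> ~~ zeros t x by apply: contra; apply: zz.
split=> [q r u /zz qZ /zz rZ /zz uZ|x q r xZ qT rT qr xq|q /zz/nbr].
- exact: tr.
- have [xs|xs] := boolP (zeros s x); last by apply: hom xq => //; apply: zz.
  have key y z : y \in t -> ~~ zeros s y -> radj y z -> zeros s z -> radj z q -> false.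
    move=> yt yZ yz zZ zq; have := hom _ _ _ yZ zZ (zz _ qT) zq yz.
    by rewrite radj_sym; apply: contraTT => _; apply: (zerosP _ _ qT).
  have [y yt xy] : exists2 y, y \in t & radj x y.
    by move: xZ; rewrite negbK => /hasP[b /mapP[y yt ->] h]; exists y.
  have [yZ|yZ] := boolP (zeros s y); last first.
    by have := key y x yt yZ; rewrite radj_sym xy xs xq => /(_ isT isT isT).
  have [w wt /andP[yw wZ]] := ex y yt yZ.
  have wx : radj w x by apply: (hom w y x); rewrite // radj_sym.
  by have := key w x wt wZ wx xs xq.
- by move=> [x [y [[xZ yZ] qx qy xy]]]; exists x, y; split=> //; split; apply: nn.
Qed.
End Zero.

Lemma tri_drop (G : sgraph) k (s : seq G) : tri (drop k s) = drop k (tri s).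
Proof. by elim: s k => [|x s IH] [|k] //=. Qed.

(** The hypothesis of [clean_extend], read off the base matrix, for the final C5 inside the core of
    the last [k] vertices. *)
Definition check_ends (cb : bmatrix) (k : nat) :=
  let H := full cb in let n := size cb in
  [&& 5 <= k, k <= n, drop (n - 5) cb == pat_C5 &
    all (fun r => has id (drop (n - 5) r) ||
      has (fun j => nth false r j && has id (drop (n - 5) (nth [::] H j))) (iota (n - k) k))
    (drop (n - k) H)].

Section Nodes.
Variable G : sgraph.
Hypotheses (G_connected : connected G) (G_atom : atom G).
Hypotheses (noP5 : ~ contains G pat_P5) (noW4 : ~ contains G pat_W4).

Lemma C5_core : check_core [:: pat_P5; pat_W4] pat_C5.
Proof. by vm_compute. Qed.

Lemma C7c_core : check_core [:: pat_P5; pat_W4; pat_C5] pat_C7c.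
Proof. by vm_compute. Qed.

Lemma ends_clean b cb k : tri b = cb -> check_ends cb k ->
  @clean G (zeros (drop (size cb - k) b)).
Proof.
move=> tb /and4P[k5 kn /eqP e5 /allP al].
have sb : size b = size cb by rewrite -tb size_tri.
have t5 : tri (drop (size cb - 5) b) = pat_C5 by rewrite tri_drop tb.
have s5 : size (drop (size cb - 5) b) = 5 by rewrite -(size_tri (drop _ _)) t5.
have [d d5] : exists d, d \in drop (size cb - 5) b.
  by case: (drop _ _) s5 => // d r _; exists d; rewrite mem_head.
have c5 : @clean G (zeros (drop (size cb - 5) b)).
  apply: (core_clean _ _ _ t5 d5 C5_core) => // p.
  by rewrite !inE => /orP[]/eqP->.
apply: clean_extend c5 _.
  move=> x; rewrite -[in drop (_ - k) b](cat_take_drop (size cb - 5) b) drop_cat.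
  case: ifP => [_|]; first by rewrite mem_cat => ->; rewrite orbT.
  by move/negbT; rewrite -leqNgt size_take sb ltn_subrL (leq_trans _ kn) ?(leq_trans _ k5) //= => h; rewrite (_ : _ - _ - _ = 0) ?drop0 //; apply/eqP; rewrite subn_eq0 leq_sub2l.
move=> y yt yZ; have := al (trace b y).
rewrite -tb full_tri -map_drop map_f ?tb // => /(_ isT).
rewrite -map_drop; case/orP => [h|/hasP[j]]; first by rewrite /zeros /trace h in yZ.
rewrite mem_iota subnK // => /andP[j1 j2].
have nj : nth [::] (rows b) j = trace b (nth d b j) by rewrite (nth_map d) // sb.
rewrite nj -map_drop (nth_map d) ?sb // => /andP[yj jZ].
exists (nth d b j); last by rewrite yj /zeros jZ.
by rewrite -(subnKC j1) -nth_drop mem_nth // size_drop sb ltn_sub2r // (leq_ltn_trans j1).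
Qed.
End Nodes.

(** * Claw-free graphs *)

(** Closed adjacency is harmless: [c = x] would make [x] adjacent to [y]. *)
Definition claw_free (G : sgraph) := forall c x y z : G,
  radj c x -> radj c y -> radj c z -> ~~ radj x y -> ~~ radj x z -> ~~ radj y z -> False.

Lemma quasi_line_of_claw_free (G : sgraph) : claw_free G ->
  ~ contains G pat_W4 -> ~ contains G pat_W5 -> quasi_line G.
Proof.
move=> claw noW4 noW5 v.
have [/eqP N0|/set0Pn[u0 u0N]] := boolP (neighbors v == set0).
  exists set0, set0; split; rewrite ?N0 ?setU0 //; by move=> x y; rewrite inE.
pose X u := [set x in neighbors v | ~~ radj u x].
(* The nonadjacency graph of the neighbourhood of [v] has no triangle, no C5 and no
   2K2; the two cliques are the nonneighbours of [u] and the other vertices. *)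
have [u uN umax] : exists2 u, u \in neighbors v &
    forall y, y \in neighbors v -> #|X y| <= #|X u|.
  have [u uN um] := @arg_maxnP _ u0 [in neighbors v] (fun y => #|X y|) u0N.
  by exists u => // y yN; apply: um.
have Nv x : x \in neighbors v -> radj v x by rewrite inE /radj => ->; rewrite orbT.
have cX : clique (X u).
  apply/cliqueE => x y; rewrite !inE -/(radj _ _) => /andP[xN ux] /andP[yN uy].
  apply/negPn/negP => xy; apply: (claw v u x y) => //; apply: Nv; rewrite ?inE //.
  by move: uN; rewrite inE.
have XN u' x : x \in X u' -> x \in neighbors v /\ ~~ radj u' x.
  by rewrite [_ \in X _]inE => /andP[].
exists (X u), [set y in neighbors v | radj u y]; split=> //; last first.
  by apply/setP => x; rewrite !inE -andb_orr orNb andbT.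
apply/cliqueE => y y'; rewrite ![_ \in [set _ in _ | _]]inE => /andP[yN uy] /andP[y'N uy'].
apply/negPn/negP => yy'.
(* Each [x] in [X u] is adjacent to exactly one of [y], [y']: to both gives a 4-wheel with rim u, y,
   x, y', and to neither gives a claw at [v]. *)
have one x : x \in X u -> radj x y -> ~~ radj x y'.
  move=> /XN[xN ux] xy; apply/negP => xy'; case: noW4; exists [:: u; y; x; y'; v].
  rewrite /= /trace /= uy uy' (negPf ux) (negPf yy') ![radj _ v]radj_sym !Nv //.
  by rewrite [radj y x]radj_sym xy xy'.
have two x : x \in X u -> ~~ radj x y -> radj x y'.
  move=> /XN[xN ux] xy; apply/negPn/negP => xy'.
  by apply: (claw v x y y') => //; apply: Nv.
(* If [y] or [y'] misses all of [X u], its nonneighbours properly contain [X u], against the choice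
   of [u]. Otherwise some x1 misses [y], some x2 misses [y'], and u, y, x2, x1, y' is the rim of a
   5-wheel. *)
have big z z' : z \in neighbors v -> z' \in neighbors v -> radj u z' -> ~~ radj z z' ->
    (forall x, x \in X u -> ~~ radj z x) -> False.
  move=> zN z'N uz' zz' all; have := umax _ zN; rewrite leqNgt => /negP[].
  apply/proper_card/properP; split.
    by apply/subsetP => x xX; have [xN _] := XN _ _ xX; rewrite inE xN all.
  by exists z'; rewrite inE ?z'N ?uz' ?zz' //= ?andbF.
have [/exists_inP[x1 x1X n1]|no1] := boolP [exists x in X u, ~~ radj x y]; last first.
  apply: (big y' y) => //; first by rewrite radj_sym.
  move=> x xX; rewrite radj_sym; apply: one => //.
  by apply/negPn; apply: contra no1 => nx; apply/exists_inP; exists x.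
have [/exists_inP[x2 x2X n2]|no2] := boolP [exists x in X u, ~~ radj x y']; last first.
  apply: (big y y') => // x xX; rewrite radj_sym; apply: contraNN no2 => xy.
  by apply/exists_inP; exists x => //; apply: one.
have a1 := two _ x1X n1.
have a2 : radj x2 y by apply: contraNT n2; apply: two.
have [[x1N u1] [x2N u2]] := (XN _ _ x1X, XN _ _ x2X).
have x12 : radj x2 x1 by move/cliqueE: cX; apply.
case: noW5; exists [:: v; u; y; x2; x1; y'].
rewrite /= /trace /= !Nv // uy uy' (negPf u1) (negPf u2) (radj_sym y x2) a2.
by rewrite (radj_sym y x1) (negPf n1) (negPf yy') x12 (negPf n2) a1.
Qed.

Section ClawCheck.
Let pats := [:: pat_P5; pat_W4; pat_W5; pat_D1; pat_A1].
Let refute := has_found 0 pats.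
Let H := full pat_C5.
Let al := core_masks pats pat_C5.

(** Two nonadjacent neighbours of a coreless vertex always produce an avoided pattern, so coreless
    vertices do not exist and a claw is determined by four nonzero traces. *)
Definition check_zero := all (fun m => all (fun m' =>
  refute (extend [:: false, true & m] (extend (true :: m') (extend (nseq 5 false) H)))) al) al.

Definition check_claw :=
  all (fun mx => let hx := extend mx H in
  all (fun my => let hy := extend (false :: my) hx in
    if refute hy then true else
  all (fun mz => let hz := extend [:: false, false & mz] hy in
    if refute hz then true else
  all (fun mc => refute (extend [:: true, true, true & mc] hz)) al) al) al) al.
End ClawCheck.

Section Claw.
Variables (G : sgraph) (s : seq G) (s0 : G).
Let pats := [:: pat_P5; pat_W4; pat_W5; pat_D1; pat_A1].
Hypothesis free : forall p, p \in pats -> ~ contains G p.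
Hypothesis tri_s : tri s = pat_C5.
Hypothesis clean_s : clean (zeros s).

Lemma check_zero_ok : check_zero. Proof. by vm_compute. Qed.
Lemma check_claw_ok : check_claw. Proof. by vm_compute. Qed.

Let wfs : all wf pats. Proof. by []. Qed.

Let fr f (t : seq G) : has_found f pats (rows t) = false.
Proof. exact: (has_found_rows free wfs). Qed.

Let rows_s : full pat_C5 = rows s.
Proof. by rewrite -tri_s full_tri. Qed.

Let nonzero x : ~~ zeros s x.
Proof.
apply/negP => xZ; have [_ _ /(_ _ xZ)[y [z [[yZ zZ] xy xz yz]]]] := clean_s.
have /allP/(_ _ (mem_core_masks free wfs tri_s yZ))/allP/(_ _ (mem_core_masks free wfs tri_s zZ)) := check_zero_ok.
have e : nseq 5 false = trace s x.
  rewrite (_ : 5 = size s); last by rewrite -size_tri tri_s.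
  move: xZ; rewrite /zeros; elim: (s) => //= a t IH.
  by rewrite negb_or => /andP[/negPf-> /IH ->].
have -> : extend [:: false, true & trace s y] (extend (true :: trace s z)
    (extend (nseq 5 false) (full pat_C5))) = rows [:: y, z, x & s].
  rewrite rows_s e -(rows_cons x s).
  by rewrite 2![rows [:: _, _ & _]]rows_cons /trace /= (radj_sym y x) (radj_sym z x) xy xz (negPf yz).
by rewrite fr.
Qed.

Lemma claw_free_of_check : claw_free G.
Proof.
move=> c x y z cx cy cz xy xz yz; have m w := mem_core_masks free wfs tri_s (nonzero w).
have := check_claw_ok; rewrite /check_claw; cbv zeta => /allP/(_ _ (m x))/allP/(_ _ (m y)).
have e2 : extend (false :: trace s y) (extend (trace s x) (full pat_C5)) = rows [:: y, x & s].
  by rewrite !rows_cons -rows_s /trace /= (radj_sym y x) (negPf xy).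
rewrite e2 fr => /allP/(_ _ (m z)).
have e3 : extend [:: false, false & trace s z] (rows [:: y, x & s]) = rows [:: z, y, x & s].
  by rewrite [RHS]rows_cons /trace /= (radj_sym z y) (radj_sym z x) (negPf yz) (negPf xz).
rewrite e3 fr => /allP/(_ _ (m c)).
have e4 : extend [:: true, true, true & trace s c] (rows [:: z, y, x & s]) = rows [:: c, z, y, x & s].
  by rewrite [RHS]rows_cons /trace /= cz cy cx.
by rewrite e4 fr.
Qed.
End Claw.

(** * Reduction from pattern to pattern *)

Definition tri_perm (H : bmatrix) :=
  fix loop (pi : seq nat) : bmatrix :=
    if pi is i :: pi' then [seq nth false (nth [::] H i) j | j <- pi'] :: loop pi' else [::].

Lemma tri_nth (G : sgraph) (b : seq G) d pi : all (gtn (size b)) pi ->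
  tri [seq nth d b i | i <- pi] = tri_perm (rows b) pi.
Proof.
elim: pi => //= i pi IH /andP[ib pib]; rewrite IH //; congr (_ :: _).
rewrite /trace -map_comp; apply/eq_in_map => j jpi /=.
have jb : j < size b := allP pib _ jpi.
by rewrite (nth_map d) // (nth_map d).
Qed.

Lemma extremal (up : bool) (w : nat -> nat) (I : seq nat) : I != [::] ->
  exists2 m, m \in I & forall j, j \in I -> if up then w j <= w m else w m <= w j.
Proof.
elim: I => // i [|i' I] IH _; first by exists i; rewrite ?inE // => j /[!inE] /eqP->; case: up {IH}.
have [m mI le] := IH isT.
have [h|h] := boolP (if up then w i <= w m else w m <= w i).
  exists m; first by rewrite inE mI orbT.
  by move=> j; rewrite inE => /orP[/eqP->//|/le].
exists i; first exact: mem_head.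
move=> j; rewrite inE => /orP[/eqP->|/le]; first by case: up {IH le h}.
by case: up {IH le} h; rewrite -ltnNge => /ltnW h k; [apply: leq_trans k h|apply: leq_trans h k].
Qed.

(* The permutations are automorphisms of the base that move [k0] to every element
   of [I]; thus [k0] can be assumed to have an extremal class. *)
Definition check_orbit (c : cert) (up : bool) (k0 : nat) (I : seq nat) (pis : seq (seq nat)) :=
  let n := size (c_base c) in let H := full (c_base c) in
  [&& k0 \in I, all (gtn n) I,
      all (fun pi => perm_eq pi (iota 0 n) && (tri_perm H pi == c_base c)) pis,
      all (fun m => has (fun pi => (nth 0 pi k0 == m) &&
        all (fun j => nth 0 pi j \in I) I) pis) I &
      all (fun kl => if up then (kl.2 == k0) && (kl.1 \in I)
                     else (kl.1 == k0) && (kl.2 \in I)) (c_le c)].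

Section Nodes.
Variable G : sgraph.
Hypotheses (G_connected : connected G) (G_atom : atom G).
Hypotheses (noP5 : ~ contains G pat_P5) (noW4 : ~ contains G pat_W4).

Definition free (pats : seq bmatrix) := forall p, p \in pats -> ~ contains G p.

Lemma nice_of_base pats c (b : seq G) d : free pats -> check pats c ->
  tri b = c_base c -> @clean G (zeros (drop (size (c_base c) - c_core c) b)) ->
  (forall k l, (k, l) \in c_le c ->
    #|[set x | trace b x == trace b (nth d b k)]| <=
    #|[set x | trace b x == trace b (nth d b l)]|) ->
  nice G.
Proof.
move=> fr ok tb [tr hom nbr] le.
have /and5P[wfs h1 h2 h3 /and5P[h4 h5 h6 h7 _]] := ok.
have zE x : zero c b x = zeros (drop (size (c_base c) - c_core c) b) x.
  by rewrite /zero /zeros /trace map_drop.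
apply: (@nice_of_checks G pats c b d fr wfs tb h7 h1 h2 _ _ _ le ok).
- by move=> q r s; rewrite !zE; apply: tr.
- by move=> x q r; rewrite !zE; apply: hom.
- by move=> q; rewrite zE => /nbr[x [y]]; rewrite -!zE; exists x, y.
Qed.

Lemma nice_node pats c : free pats -> check pats c -> c_le c = [::] ->
  check_ends (c_base c) (c_core c) -> contains G (c_base c) -> nice G.
Proof.
move=> fr ok le0 ends [b tb]; have cb := ends_clean G_connected G_atom noP5 noW4 tb ends.
case: b tb cb => [|d b] tb cb; first by
  move: ends; rewrite -tb => /and3P[k5]; rewrite leqn0 => /eqP k0; rewrite k0 in k5.
by apply: (nice_of_base (d := d) fr ok tb cb) => k l; rewrite le0.
Qed.

Lemma nice_node_orbit pats c up k0 I pis : free pats -> check pats c ->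
  check_orbit c up k0 I pis ->
  check_ends (c_base c) (c_core c) -> contains G (c_base c) -> nice G.
Proof.
move=> fr ok /and5P[k0I /allP In /allP pisP /allP trP /allP leP] ends [b tb].
have sb : size b = size (c_base c) by rewrite -tb size_tri.
have n0 : 0 < size b by rewrite sb; apply: leq_ltn_trans (In _ k0I).
have [d _] : exists d : G, true by case: (b) n0 => // d r _; exists d.
pose w i := #|[set x | trace b x == trace b (nth d b i)]|.
have [|m mI ext] := @extremal up w I; first by case: (I) k0I.
have /hasP[pi piP /andP[/eqP pim /allP piI]] := trP m mI.
have /andP[peq /eqP tpi] := pisP _ piP.
(* The relabelled copy has the extremal class at position [k0]. It has the same members as [b],
   hence induces the same partition into classes, and the sizes carry over. *)
pose b' := [seq nth d b i | i <- pi].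
have pn : all (gtn (size b)) pi.
  by apply/allP => i; rewrite (perm_mem peq) mem_iota sb.
have tb' : tri b' = c_base c by rewrite tri_nth // -full_tri tb tpi.
have sp : size pi = size (c_base c) by rewrite (perm_size peq) size_iota.
have pb : b' =i b.
  move=> x; apply/mapP/idP => [[i ip ->]|xb]; first by apply/mem_nth/(allP pn).
  exists (index x b); last by rewrite nth_index.
  by rewrite (perm_mem peq) mem_iota -sb index_mem.
have tE x y : (trace b' x == trace b' y) = (trace b x == trace b y).
  apply/eqP/eqP => /eq_in_map h; apply/eq_in_map => z.
    by rewrite -pb => /h.
  by rewrite pb => /h.
have wE j : j < size (c_base c) ->
    #|[set x | trace b' x == trace b' (nth d b' j)]| = w (nth 0 pi j).
  by move=> jn; apply: eq_card => x; rewrite !inE tE (nth_map 0) // sp.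
apply: (nice_of_base (d := d) fr ok tb') => [|k l kl].
  exact: (ends_clean G_connected G_atom noP5 noW4 tb' ends).
have := leP _ kl; case: (up) ext => ext /= /andP[/eqP e h].
  by rewrite !wE ?e ?pim ?ext ?piI //; apply: In.
by rewrite !wE ?e ?pim ?ext ?piI //; apply: In.
Qed.

End Nodes.

(** * Elimination of the patterns *)

Section Chain.
Variable G : sgraph.
Hypotheses (G_connected : connected G) (G_atom : atom G).
Hypotheses (noP5 : ~ contains G pat_P5) (noW4 : ~ contains G pat_W4).

Lemma free_nil : free G [::].
Proof. by []. Qed.

Lemma free_cons p ps : ~ contains G p -> free G ps -> free G (p :: ps).
Proof. by move=> np nps q; rewrite inE => /orP[/eqP->|/nps]. Qed.

Let node := nice_node G_connected G_atom noP5 noW4.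
Let orbit := nice_node_orbit G_connected G_atom noP5 noW4.

Ltac avoid := repeat (apply: free_cons; [by [] |]); exact: free_nil.
Ltac by_node ck := apply: (node _ ck) => //; avoid.
Ltac assume p lem := case: (contains_dec G p) => [/lem //|?].

(** The listed automorphisms take vertex 7 to each of the twelve vertices, so its class may be
    assumed largest. *)
Lemma nice_H12 : contains G pat_H12 -> nice G.
Proof.
apply: (@orbit _ _ true 7 (iota 0 12) (codes
  [:: 0x0123456789ab; 0x023451689ab7; 0x03451269ab78; 0x0154326a987b;
      0x0215436ba987; 0x7163a920854b; 0x20b458719a36; 0x10743ab29856;
      0x20854b73a916; 0x30915784ba26; 0x10a347b58926; 0x170a34b65892]%dg)
  _ check_H12) => //; avoid.
Qed.

Lemma nice_zICO : contains G pat_zICO -> nice G.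
Proof.
assume pat_H12 nice_H12.
apply: (@orbit _ _ false 1 (iota 1 5) (codes
  [:: 0x0123456789a; 0x021543a9876; 0x0321546a987; 0x04321576a98; 0x051234a6789]%dg)
  _ check_zICO) => //; avoid.
Qed.

Lemma nice_HQ4 : contains G pat_HQ4 -> nice G.
Proof. assume pat_zICO nice_zICO; by_node check_HQ4. Qed.

Lemma nice_zDD : contains G pat_zDD -> nice G.
Proof. assume pat_HQ4 nice_HQ4; by_node check_zDD. Qed.

Lemma nice_W5 : contains G pat_W5 -> nice G.
Proof. assume pat_zDD nice_zDD; by_node check_W5. Qed.

Hypothesis noW5 : ~ contains G pat_W5.

Lemma nice_ICO : contains G pat_ICO -> nice G.
Proof.
apply: (@orbit _ _ false 0 (iota 0 5) (codes
  [:: 0x0123456789; 0x1043298765; 0x2104359876; 0x3210465987; 0x4012395678]%dg)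
  _ check_ICO) => //; avoid.
Qed.

Lemma nice_Q4X : contains G pat_Q4X -> nice G.
Proof.
apply: (@orbit _ _ false 8 (iota 0 13) (codes
  [:: 0x0123456789abc; 0x3210547698cba; 0x63219705a48cb; 0x4701c328b659a;
      0x70128634c59ab; 0x36591ba20c847; 0x48cb09a715632; 0x59ab38c624701;
      0x07482bc13a956; 0x123679504abc8; 0x210768435cba9; 0x10743c826ba95;
      0x23650a917bc84]%dg)
  _ check_Q4X) => //; avoid.
Qed.

Lemma nice_Q4 : contains G pat_Q4 -> nice G.
Proof. assume pat_ICO nice_ICO; assume pat_Q4X nice_Q4X; by_node check_Q4. Qed.

Lemma nice_Q4e : contains G pat_Q4e -> nice G.
Proof. assume pat_ICO nice_ICO; by_node check_Q4e. Qed.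

Lemma nice_D123 : contains G pat_D123 -> nice G.
Proof.
assume pat_ICO nice_ICO; assume pat_Q4 nice_Q4; assume pat_Q4e nice_Q4e.
by_node check_D123.
Qed.

Lemma nice_G7 : contains G pat_G7 -> nice G.
Proof. assume pat_D123 nice_D123; by_node check_G7. Qed.

Lemma nice_G6 : contains G pat_G6 -> nice G.
Proof. assume pat_G7 nice_G7; by_node check_G6. Qed.

Lemma nice_G5 : contains G pat_G5 -> nice G.
Proof. assume pat_G7 nice_G7; assume pat_G6 nice_G6; by_node check_G5. Qed.

Lemma nice_G2 : contains G pat_G2 -> nice G.
Proof.
assume pat_G7 nice_G7; assume pat_G6 nice_G6; assume pat_G5 nice_G5.
by_node check_G2.
Qed.

Lemma nice_G8 : contains G pat_G8 -> nice G.
Proof.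
assume pat_D123 nice_D123; assume pat_G7 nice_G7; assume pat_G6 nice_G6.
assume pat_G5 nice_G5; assume pat_G2 nice_G2.
have a : contains G pat_G8a -> nice G by by_node check_G8a.
have b : contains G pat_G8b -> nice G by by_node check_G8b.
assume pat_G8a a; assume pat_G8b b; by_node check_G8.
Qed.

Lemma nice_T13 : contains G pat_T13 -> nice G.
Proof.
assume pat_D123 nice_D123; assume pat_G7 nice_G7; assume pat_G6 nice_G6.
assume pat_G5 nice_G5; assume pat_G2 nice_G2; assume pat_G8 nice_G8.
by_node check_T13.
Qed.

Lemma nice_G1 : contains G pat_G1 -> nice G.
Proof.
assume pat_D123 nice_D123; assume pat_G7 nice_G7; assume pat_G6 nice_G6.
assume pat_G5 nice_G5; assume pat_G2 nice_G2; assume pat_T13 nice_T13.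
by_node check_G1.
Qed.

Lemma nice_D1 : contains G pat_D1 -> nice G.
Proof.
assume pat_D123 nice_D123; assume pat_G7 nice_G7; assume pat_G6 nice_G6.
assume pat_G5 nice_G5; assume pat_G2 nice_G2; assume pat_G8 nice_G8.
assume pat_T13 nice_T13; assume pat_G1 nice_G1; by_node check_D1.
Qed.

Lemma nice_A1 : contains G pat_A1 -> nice G.
Proof. assume pat_D1 nice_D1; by_node check_A1. Qed.

Lemma nice_or_quasi_line : contains G pat_C5 -> nice G \/ quasi_line G.
Proof.
case: (contains_dec G pat_D1) => [/nice_D1|noD1]; first by left.
case: (contains_dec G pat_A1) => [/nice_A1|noA1 [s ts]]; first by left.
right; apply: quasi_line_of_claw_free => //.
have [s0 s0s] : exists s0, s0 \in s.
  by case: s ts => // s0 r _; exists s0; rewrite mem_head.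
apply: (claw_free_of_check _ ts); first avoid.
by apply: (core_clean _ _ _ ts s0s C5_core) => //; avoid.
Qed.
End Chain.

(** Here the whole base is the core, so [core_clean] applies to it directly, with C5 among the
    avoided patterns. *)
Lemma nice_C7c (G : sgraph) : connected G -> atom G ->
  ~ contains G pat_P5 -> ~ contains G pat_W4 -> ~ contains G pat_C5 ->
  contains G pat_C7c -> nice G.
Proof.
move=> Gc Ga noP5 noW4 noC5 [b tb].
have [d db] : exists d, d \in b by case: b tb => // d r _; exists d; rewrite mem_head.
have fr : free G [:: pat_P5; pat_W4; pat_C5] by do 3 (apply: free_cons => //).
apply: (nice_of_base (d := d) fr check_C7c tb) => //=.
rewrite drop0; exact: (core_clean fr _ _ tb db C7c_core).
Qed.

Theorem theorem3 (G : sgraph)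
    (G_connected : connected G)
    (G_free : free_of [:: path_graph 5; wheel 4] G)
    (G_atom : atom G) :
  [/\ (has_induced G (wheel 5) -> nice G),
      (has_induced G (cycle_graph 5) -> ~ has_induced G (wheel 5) ->
         nice G \/ quasi_line G)
    & (has_induced G (compl (cycle_graph 7)) ->
         ~ has_induced G (cycle_graph 5) -> nice G)].
Proof.
have noP5 : ~ contains G pat_P5.
  rewrite -P5_tri => /induced_contains h; apply: (G_free (path_graph 5)); first by left.
  by apply: h; [case; do 5 case=> //|vm_compute].
have noW4 : ~ contains G pat_W4.
  rewrite -W4_tri => /induced_contains h; apply: (G_free (wheel 4)); first by right; left.
  by apply: h; [case=> // -[]; do 4 case=> //|vm_compute].
split=> [W5|C5 noW5|C7 noC5].
- apply: (nice_W5 G_connected G_atom noP5 noW4).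
  by rewrite -W5_tri; apply: contains_induced.
- apply: (nice_or_quasi_line G_connected G_atom noP5 noW4).
    rewrite -W5_tri => /induced_contains h; apply: noW5.
    by apply: h; [case=> // -[]; do 5 case=> //|vm_compute].
  by rewrite -C5_tri; apply: contains_induced.
- apply: (nice_C7c G_connected G_atom noP5 noW4).
    rewrite -C5_tri => /induced_contains h; apply: noC5.
    by apply: h; [case; do 5 case=> //|vm_compute].
  by rewrite -C7c_tri; apply: contains_induced.
Qed.
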